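(* Let $\Bbbk$ be a commutative ring, $\lambda\in\Bbbk$ and $i,j\in\{2,\infty\}$. Let $B^\lambda_{i,j}$ be the free $\Bbbk$-module on the set $\mathcal T_{i,j}$ of decorated trees, endowed with the product $\diamond_\lambda$, let $\beta_{i,j}$ be the linear map on it, and let $Y\in\mathcal T_{i,j}$ be the decorated tree with a single internal node (the root, labeled $0$) having exactly two children, both leaves, whose unique angle is labeled $1$ (all defined in the context). Then the triple $(B^\lambda_{i,j},\,Y,\,\beta_{i,j})$ is the initial object in the category $\mathcal B^\lambda_{i,j}$ (in particular it is an object of this category).
   Context: All algebras are associative $\Bbbk$-algebras, not necessarily unital. \textbf{Baxter algebras.} A Baxter algebra of weight $\lambda$ is a pair $(A,\beta)$ with $A$ an algebra and $\beta:A\to A$ linear (a Baxter operator) satisfying $\beta(a)\beta(b)=\beta(\beta(a)b+a\beta(b)+\lambda ab)$ for all $a,b\in A$. The category $\mathcal B^\lambda_{\infty,\infty}$ has as objects the triples $(A,x,\beta)$ with $(A,\beta)$ a Baxter algebra of weight $\lambda$ and $x\in A$; a morphism $(A,x,\beta)\to(B,y,\gamma)$ is a morphism of algebras $f:A\to B$ with $f(x)=y$ and $f\beta=\gamma f$. For $i,j\in\{2,\infty\}$, $\mathcal B^\lambda_{i,j}$ is the full subcategory of objects $(A,x,\beta)$ satisfying $x^2=x$ if $i=2$, and $\beta^2=-\lambda\beta$ if $j=2$. \textbf{Decorated trees.} In a rooted planar tree, a node is a leaf if it has no children and internal otherwise; an angle is the sector between two consecutive children of an internal node. $\mathcal T_{\infty,\infty}$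 is the set of finite rooted planar trees having at least one internal node, with each angle labeled by a positive integer and each internal node labeled by a nonnegative integer, such that: every internal node has at least two children; among the children of each node, only the leftmost and rightmost can be leaves; only the root may have label $0$. $\mathcal T_{\infty,2}$ is the subset of trees all of whose internal node labels are $\le 1$; $\mathcal T_{2,\infty}$ is the subset of trees all of whose angle labels are $1$; $\mathcal T_{2,2}=\mathcal T_{\infty,2}\cap\mathcal T_{2,\infty}$. $\mathcal T^+_{i,j}$ (resp. $\mathcal T^0_{i,j}$) is the subset of trees with positive (resp. zero) root label. Let $\bullet$ be the unlabeled tree with a single node, $\widehat{\mathcal T}_{i,j}=\mathcal T_{i,j}\cup\{\bullet\}$, $\widehat{\mathcal T}^+_{i,j}=\mathcal T^+_{i,j}\cup\{\bullet\}$. \textbf{Grafting and de-grafting.} Define $G:\bigcup_{n\ge1}(\widehat{\mathcal T}^+_{i,j})^n\times(\mathbb Z^+)^{n-1}\to\widehat{\mathcal T}_{i,j}$ by $G(t)=t$ for $n=1$; for $n\ge2$, $G(t_1,\dots,t_n;i_1,\dots,i_{n-1})$ is obtained by attaching $t_1,\dots,t_n$, left to right, as the subtrees at the children of a new root labeled $0$, with label $i_k$ in the angle between the $k$-th and $(k+1)$-th children, and then normalizing: for each $1<k<n$ with $t_k=\bullet$, that leaf and its edge are removed and the two adjacent angles are merged into one angle labeled by the sum of their labels (several additions may occur). When $i=2$ additions follow the convention $1+1=1$, so all angle labels remain equal to $1$. For $t\in\mathcal T_{i,j}^0$ put $H(t)=(t_1,\dots,t_n;i_1,\dots,i_{n-1})$,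 where $t_k$ is the subtree at the $k$-th child of the root and $i_k$ the label of the angle between the $k$-th and $(k+1)$-th children; for $t\in\mathcal T^+_{i,j}$ put $H(t)=t$ (so $n=1$, $t_1=t$). \textbf{Operator and products.} Let $B_{i,j}$, $\widehat B_{i,j}$ be the free $\Bbbk$-modules on $\mathcal T_{i,j}$, $\widehat{\mathcal T}_{i,j}$; all maps are extended (multi)linearly. For $t\in\mathcal T_{i,j}$ with root label $a$: if $j=\infty$, $\beta_{i,j}(t)$ is $t$ with root label changed to $a+1$; if $j=2$, $\beta_{i,j}(t)$ is $(-\lambda)^a$ times the tree $t$ with root label changed to $1$. Also $\beta_{i,j}(\bullet)=\bullet$. For $t\in\mathcal T_{i,j}^+$ with root label $a$, $\overline t$ is $t$ with root label changed to $a-1$; $\overline\bullet=\bullet$. The product $\ast_\lambda$ on $\widehat B_{i,j}$ and the product $\diamond_\lambda$ on $B_{i,j}$ are defined by mutual recursion: $\bullet\ast_\lambda u=u\ast_\lambda\bullet=u$ for $u\in\widehat{\mathcal T}_{i,j}$; for $t,s\in\mathcal T_{i,j}$ with $H(t)=(t_1,\dots,t_n;i_1,\dots,i_{n-1})$ and $H(s)=(s_1,\dots,s_m;j_1,\dots,j_{m-1})$, $$t\diamond_\lambda s=G\bigl(t_1,\dots,t_{n-1},\beta_{i,j}(\overline t_n\ast_\lambda\overline s_1),s_2,\dots,s_m;\,i_1,\dots,i_{n-1},j_1,\dots,j_{m-1}\bigr);$$ and for $u,v\in\mathcal T_{i,j}$, $u\ast_\lambda v=\beta_{i,j}(u)\diamond_\lambda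 v+u\diamond_\lambda\beta_{i,j}(v)+\lambda\,u\diamond_\lambda v$. $B^\lambda_{i,j}$ denotes $B_{i,j}$ with the product $\diamond_\lambda$. *)

(* Defs.v *)
From HB Require Import structures.
From mathcomp Require Import all_boot all_order all_algebra finmap zify.
From mathcomp.multinomials Require Import monalg.

Set Implicit Arguments.
Unset Strict Implicit.
Unset Printing Implicit Defensive.

Import GRing.Theory.
Local Open Scope ring_scope.

(* [{malg k[T]}] is the type of finitely supported functions T -> k; the      *)
(* library gives it its k-module structure only when 1 != 0 in k, so the      *)
(* structure is put here on an alias, for an arbitrary ring k.                *)
Definition freemod (k : pzRingType) (T : choiceType) : Type := {malg k[T]}.

Section FreeModule.
Context (k : pzRingType) (T : choiceType).

HB.instance Definition _ := GRing.Zmodule.on (freemod k T).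

Definition fscale (c : k) (x : freemod k T) : freemod k T :=
  [malg t in msupp x => c * x@_t].

Lemma fscaleE c x t : (fscale c x)@_t = c * x@_t.
Proof. by rewrite /fscale mcoeffE; case: msuppP; rewrite ?mulr0. Qed.

Fact fscaleA a b x : fscale a (fscale b x) = fscale (a * b) x.
Proof. by apply/malgP=> t; rewrite !fscaleE mulrA. Qed.

Fact fscale1r : left_id 1 fscale.
Proof. by move=> x; apply/malgP=> t; rewrite fscaleE mul1r. Qed.

Fact fscaleDr : right_distributive fscale +%R.
Proof.
by move=> c x y; apply/malgP=> t; rewrite fscaleE !mcoeffD !fscaleE mulrDr.
Qed.

Fact fscaleDl x : {morph fscale^~ x : a b / a + b}.
Proof.
by move=> a b; apply/malgP=> t; rewrite fscaleE mcoeffD !fscaleE mulrDl.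
Qed.

HB.instance Definition _ := GRing.Zmodule_isLmodule.Build k (freemod k T)
  fscaleA fscale1r fscaleDr fscaleDl.

Definition fbasis (t : T) : freemod k T := << 1 *g t >>.

Lemma mcoeff_fscale c (x : freemod k T) t : (c *: x)@_t = c * x@_t.
Proof. exact: fscaleE. Qed.

End FreeModule.

Arguments fbasis {k T} t.

Section LinearExtension.
Context (k : pzRingType).

Definition lin (T : choiceType) (V : lmodType k) (f : T -> V)
  (x : freemod k T) : V := \sum_(t <- msupp x) x@_t *: f t.

Definition bilin (S T : choiceType) (V : lmodType k) (f : S -> T -> V)
  (x : freemod k S) (y : freemod k T) : V := lin (fun s => lin (f s) y) x.

Section Theory.
Context (T : choiceType) (V : lmodType k).
Implicit Types (f g : T -> V) (x : freemod k T).

Lemma lin_widen f x (d : {fset T}) :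
  (msupp x `<=` d)%fset -> lin f x = \sum_(t <- d) x@_t *: f t.
Proof.
move=> le_xd; rewrite /lin (big_fset_incl _ le_xd) // => t _ tNx.
by rewrite mcoeff_outdom // scale0r.
Qed.

Lemma lin_is_linear f : linear (lin f).
Proof.
move=> c x y; pose d := (msupp x `|` msupp y `|` msupp (c *: x + y)%R)%fset.
have le_xd : (msupp x `<=` d)%fset.
  by apply/fsubsetP=> t t_x; rewrite !inE t_x.
have le_yd : (msupp y `<=` d)%fset.
  by apply/fsubsetP=> t t_y; rewrite !inE t_y orbT.
have le_zd : (msupp (c *: x + y)%R `<=` d)%fset.
  by apply/fsubsetP=> t t_z; rewrite !inE t_z !orbT.
rewrite (lin_widen f le_xd) (lin_widen f le_yd) (lin_widen f le_zd).
rewrite scaler_sumr -big_split /=; apply: eq_bigr => t _.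
by rewrite mcoeffD mcoeff_fscale scalerDl scalerA.
Qed.

HB.instance Definition _ f :=
  GRing.isLinear.Build k (freemod k T) V *:%R (lin f) (lin_is_linear f).

Lemma msupp_fbasis t u : u \in msupp (fbasis t : freemod k T) -> u = t.
Proof.
move=> u_t; have /fsubsetP/(_ u u_t) := @msuppU_le T k t 1.
by rewrite inE => /eqP.
Qed.

Lemma lin_fbasis f t : lin f (fbasis t) = f t.
Proof.
rewrite (lin_widen f (@msuppU_le T k t 1)) big_seq_fset1.
by rewrite mcoeffUU scale1r.
Qed.

Lemma eq_lin f g x : {in msupp x, f =1 g} -> lin f x = lin g x.
Proof. by move=> fg; apply: eq_big_seq => t /fg ->. Qed.

End Theory.

End LinearExtension.

(* [Node a t0 [:: (i1, t1); ...; (in, tn)]] is an internal node labeled a     *)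
(* with children t0, ..., tn, where ik labels the angle between the children  *)
(* t(k-1) and tk.                                                             *)
Inductive dtree := Leaf | Node of nat & dtree & seq (nat * dtree).

Section DtreeInd.
Context (P : dtree -> Prop) (PLeaf : P Leaf).
Context (PNode : forall a t s,
  P t -> foldr (fun p Q => P p.2 /\ Q) True s -> P (Node a t s)).

Fixpoint dtree_nested_ind t : P t :=
  match t with
  | Leaf => PLeaf
  | Node a t0 s =>
    let fix loop s : foldr (fun p Q => P p.2 /\ Q) True s :=
      if s is p :: s' then conj (dtree_nested_ind p.2) (loop s') else I in
    PNode a (dtree_nested_ind t0) (loop s)
  end.

End DtreeInd.

Fixpoint dtree_enc (t : dtree) : GenTree.tree nat :=
  match t with
  | Leaf => GenTree.Node 0 [::]
  | Node a t0 s => GenTree.Node a.+1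
      (dtree_enc t0 :: [seq GenTree.Node p.1 [:: dtree_enc p.2] | p <- s])
  end.

Fixpoint dtree_dec (g : GenTree.tree nat) : dtree :=
  match g with
  | GenTree.Node a.+1 (g0 :: l) =>
      Node a (dtree_dec g0)
        [seq if h is GenTree.Node b [:: h0] then (b, dtree_dec h0)
             else (0%N, Leaf) | h <- l]
  | _ => Leaf
  end.

Fact dtree_encK : cancel dtree_enc dtree_dec.
Proof.
elim/dtree_nested_ind=> [//|a t s /= -> IHs]; congr (Node a t _).
by elim: s IHs => [//|[b u] s IH] /= [-> /IH ->].
Qed.

HB.instance Definition _ := Countable.copy dtree (can_type dtree_encK).

(* Throughout, [Two] and [Infty] are the two values of the indices i and j.   *)
Variant tindex := Two | Infty.

Section TreePredicates.

Definition is_leaf (t : dtree) : bool := if t is Leaf then true else false.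

(* The value at [Leaf] is junk. *)
Definition label (t : dtree) : nat := if t is Node a _ _ then a else 0.

Definition children (t : dtree) : seq dtree :=
  if t is Node _ t0 s then t0 :: [seq p.2 | p <- s] else [::].

Definition angles (t : dtree) : seq nat :=
  if t is Node _ _ s then [seq p.1 | p <- s] else [::].

(* One entry for each node of t, the root coming first. *)
Fixpoint subtrees (t : dtree) : seq dtree :=
  t :: if t is Node _ t0 s
       then subtrees t0 ++ flatten [seq subtrees p.2 | p <- s] else [::].

Definition proper_subtrees (t : dtree) : seq dtree := behead (subtrees t).

(* A list without its first and its last elements. *)
Definition inner (T : Type) (s : seq T) : seq T :=
  if s is x :: s' then behead (belast x s') else [::].

Definition in_Tinfty (t : dtree) : bool :=
  [&& ~~ is_leaf t,
      all (fun u => is_leaf u || (1 < size (children u))%N) (subtrees t),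
      all (fun u => all (predC is_leaf) (inner (children u))) (subtrees t),
      all (fun u => is_leaf u || (0 < label u)%N) (proper_subtrees t) &
      all (fun u => all (fun n => 0 < n)%N (angles u)) (subtrees t)].

Definition in_T (i j : tindex) (t : dtree) : bool :=
  [&& in_Tinfty t,
      if i is Two then all (fun u => all (pred1 1%N) (angles u)) (subtrees t)
      else true &
      if j is Two then all (fun u => label u <= 1)%N (subtrees t) else true].

End TreePredicates.

Record Ttree (i j : tindex) := TTree { tval :> dtree; tvalP : in_T i j tval }.

HB.instance Definition _ (i j : tindex) := [isSub for @tval i j].
HB.instance Definition _ (i j : tindex) := [Choice of Ttree i j by <:].

Section Grafting.
Context (i : tindex).

Definition add_angle (a b : nat) : nat := if i is Two then 1 else (a + b)%N.

(* [(t1, [:: (i1, t2); ...; (i(n-1), tn)])] stands for                        *)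
(* (t1, ..., tn; i1, ..., i(n-1)).                                            *)
Definition forest : Type := dtree * seq (nat * dtree).

Definition first_tree (f : forest) : dtree := f.1.
Definition last_tree (f : forest) : dtree := last f.1 [seq p.2 | p <- f.2].

(* The normalization of [(a, u) :: s]: if the leaf u is not the last child,   *)
(* it is removed and the angle a is merged with the next one.                 *)
Fixpoint normalize (a : nat) (u : dtree) (s : seq (nat * dtree)) :
    seq (nat * dtree) :=
  if s is (b, v) :: s' then
    if is_leaf u then normalize (add_angle a b) v s'
    else (a, u) :: normalize b v s'
  else [:: (a, u)].

Definition graft (f : forest) : dtree :=
  if f.2 is (a, u) :: s then Node 0 f.1 (normalize a u s) else f.1.

Definition degraft (t : dtree) : forest :=
  if t is Node 0 t1 s then (t1, s) else (t, [::]).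

(* (t1, ..., t(n-1), w, s2, ..., sm; i1, ..., i(n-1), j1, ..., j(m-1)) for    *)
(* f = (t1, ..., tn; i1, ..., i(n-1)) and g = (s1, ..., sm; j1, ..., j(m-1)). *)
Definition glue (f : forest) (w : dtree) (g : forest) : forest :=
  if f.2 is p :: s
  then (f.1, belast p s ++ ((last p s).1, w) :: g.2)
  else (w, g.2).

(* The tree with its root label decreased by 1, if that label is positive. *)
Definition lower (t : dtree) : dtree :=
  if t is Node a t0 s then Node a.-1 t0 s else Leaf.

End Grafting.

(* Number of internal nodes plus sum of their labels. *)
Fixpoint weight (t : dtree) : nat :=
  if t is Node a t0 s then (a.+1 + weight t0 + sumn [seq weight p.2 | p <- s])%N
  else 0.

Section Products.
Context (k : comPzRingType) (lam : k) (i j : tindex).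

Local Notation F := (freemod k dtree).

Definition beta_tree (t : dtree) : F :=
  match t with
  | Leaf => fbasis Leaf
  | Node a t0 s =>
      match j with
      | Infty => fbasis (Node a.+1 t0 s)
      | Two => (- lam) ^+ a *: fbasis (Node 1 t0 s)
      end
  end.

Section Step.
Context (dia : dtree -> dtree -> F).

Definition ast_step (u v : dtree) : F :=
  match u, v with
  | Leaf, _ => fbasis v
  | _, Leaf => fbasis u
  | _, _ => bilin dia (beta_tree u) (fbasis v)
            + bilin dia (fbasis u) (beta_tree v) + lam *: dia u v
  end.

Definition dia_step (t s : dtree) : F :=
  let f := degraft t in let g := degraft s in
  lin (fun w => fbasis (graft i (glue f w g)))
    (lin beta_tree (ast_step (lower (last_tree f)) (lower (first_tree g)))).

End Step.

(* The recursion defining the two products, cut off at depth n. The cutoff    *)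
(* used in [diamond] is never reached: see [astE] and [diamondE].             *)
Fixpoint dia_rec (n : nat) : dtree -> dtree -> F :=
  if n is n'.+1 then dia_step (dia_rec n') else fun _ _ => 0.

Definition diamond (t s : dtree) : F := dia_rec (weight t + weight s).+1 t s.

Definition ast (u v : dtree) : F := ast_step diamond u v.

End Products.

Section Recursion.
Context (k : comPzRingType) (lam : k) (i j : tindex).

Let raise (t : dtree) : dtree :=
  if t is Node a t0 s then Node (if j is Two then 1 else a.+1) t0 s else Leaf.

Let msupp_beta t u : u \in msupp (beta_tree lam j t) -> u = raise t.
Proof.
rewrite /raise; case: t => [|a t0 s] /=; first exact: msupp_fbasis.
case: j; last exact: msupp_fbasis.
rewrite -mcoeff_neq0 mcoeff_fscale => nz_u; apply: (@msupp_fbasis k).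
by rewrite -mcoeff_neq0; apply: contra_neq nz_u => ->; rewrite mulr0.
Qed.

Let weight_last p (s : seq (nat * dtree)) :
  (weight (last p s).2 <= weight p.2 + sumn [seq weight q.2 | q <- s])%N.
Proof.
elim: s p => [|q s IH] p /=; first by rewrite addn0.
by apply: leq_trans (IH q) _; rewrite leq_addl.
Qed.

Let weight_raise u : (weight (raise (lower u)) <= (weight u).+1)%N.
Proof.
by case: u => [//|a t s] /=; case: j => /=; case: a => [|a] /=; rewrite ?leqnn; lia.
Qed.

Let small_last t u : u = lower (last_tree (degraft t)) -> ~~ is_leaf u ->
  (weight u < weight t)%N /\ (weight (raise u) <= weight t)%N.
Proof.
rewrite /last_tree; case: t => [|[|a] t s] -> //.
- set c := last _ _ => nl.
  have lt_c : (weight c <= weight t + sumn [seq weight p.2 | p <- s])%N.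
    rewrite /c; case: s {c nl} => [|p s] /=; first by rewrite addn0.
    rewrite (last_map (fun p : nat * dtree => p.2)).
    by apply: leq_trans (weight_last _ _) _; rewrite leq_addl.
  have lw : (weight (lower c) <= weight c)%N by case: (c) => //= [a ? ?]; lia.
  by have := weight_raise c; rewrite /=; lia.
- by move=> _; rewrite /= /raise /=; case: j => /=; lia.
Qed.

Let small_first t u : u = lower (first_tree (degraft t)) -> ~~ is_leaf u ->
  (weight u < weight t)%N /\ (weight (raise u) <= weight t)%N.
Proof.
rewrite /first_tree; case: t => [|[|a] t s] -> //.
- move=> /= nl; have := weight_raise t.
  have : (weight (lower t) <= weight t)%N by case: (t) => //= [a ? ?]; lia.
  by lia.
- by move=> _; rewrite /= /raise /=; case: j => /=; lia.
Qed.

Let eq_ast_step d1 d2 u v :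
    (~~ is_leaf u -> ~~ is_leaf v ->
     [/\ d1 (raise u) v = d2 (raise u) v, d1 u (raise v) = d2 u (raise v) &
         d1 u v = d2 u v]) ->
  ast_step lam j d1 u v = ast_step lam j d2 u v.
Proof.
case: u v => [|a t s] [|b t' s'] // /(_ isT isT)[e1 e2 e3].
set u := Node a t s in e1 e2 e3 *; set v := Node b t' s' in e1 e2 e3 *.
have E1 : bilin d1 (beta_tree lam j u) (fbasis v) =
          bilin d2 (beta_tree lam j u) (fbasis v).
  apply: eq_lin => x /msupp_beta ->; apply: eq_lin => y /msupp_fbasis ->.
  exact: e1.
have E2 : bilin d1 (fbasis u) (beta_tree lam j v) =
          bilin d2 (fbasis u) (beta_tree lam j v).
  apply: eq_lin => x /msupp_fbasis ->; apply: eq_lin => y /msupp_beta ->.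
  exact: e2.
by rewrite [LHS]/= [RHS]/= -/u -/v E1 E2 e3.
Qed.

Let eq_dia_step n d1 d2 t s :
    (forall t' s', (weight t' + weight s' < n)%N -> d1 t' s' = d2 t' s') ->
    (weight t + weight s <= n)%N ->
  dia_step lam i j d1 t s = dia_step lam i j d2 t s.
Proof.
move=> e le_n; rewrite /dia_step; congr (lin _ (lin _ _)).
apply: eq_ast_step => /(small_last erefl)[u1 u2] /(small_first erefl)[v1 v2].
by split; apply: e; lia.
Qed.

Let dia_rec_stable n m t s :
    (weight t + weight s < n)%N -> (weight t + weight s < m)%N ->
  dia_rec lam i j n t s = dia_rec lam i j m t s.
Proof.
elim: n m t s => [//|n IH] [//|m] t s ltn ltm /=.
apply: (eq_dia_step (n := (weight t + weight s)%N)) => // t' s' lt'.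
by apply: IH; lia.
Qed.

Lemma astE u v :
  ast lam i j u v =
    if is_leaf u then fbasis v else if is_leaf v then fbasis u else
    bilin (diamond lam i j) (beta_tree lam j u) (fbasis v)
    + bilin (diamond lam i j) (fbasis u) (beta_tree lam j v)
    + lam *: diamond lam i j u v.
Proof. by case: u v => [|a t s] [|b t' s']. Qed.

Lemma diamondE t s :
  let f := degraft t in let g := degraft s in
  diamond lam i j t s =
    lin (fun w => fbasis (graft i (glue f w g)))
      (lin (beta_tree lam j)
         (ast lam i j (lower (last_tree f)) (lower (first_tree g)))).
Proof.
rewrite /= {1}/diamond [LHS]/=.
apply: (eq_dia_step (n := (weight t + weight s)%N)) => // t' s' lt'.
by apply: dia_rec_stable; lia.
Qed.

End Recursion.

Section Closure.
Context (k : comPzRingType) (lam : k) (i j : tindex).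

Let angle_ok (n : nat) : bool :=
  (0 < n)%N && (if i is Two then n == 1%N else true).

Let label_ok (n : nat) : bool := if j is Two then (n <= 1)%N else true.

Let loc (u : dtree) : bool :=
  is_leaf u || [&& (1 < size (children u))%N,
    all (predC is_leaf) (inner (children u)), all angle_ok (angles u) &
    label_ok (label u)].

(* The trees of positive root label, and the leaf. *)
Definition in_That_pos (t : dtree) : bool :=
  is_leaf t || (in_T i j t && (0 < label t)%N).

Let pos (u : dtree) : bool := is_leaf u || (0 < label u)%N.

Let in_TE t : in_T i j t =
  [&& ~~ is_leaf t, all loc (subtrees t) & all pos (proper_subtrees t)].
Proof.
rewrite /in_T /in_Tinfty; case: (is_leaf t) => //=.
set st := subtrees t.
have -> : all loc st =
  [&& all (fun u => is_leaf u || (1 < size (children u))%N) st,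
      all (fun u => all (predC is_leaf) (inner (children u))) st,
      all (fun u => all (fun n => 0 < n)%N (angles u)) st,
      (if i is Two then all (fun u => all (pred1 1%N) (angles u)) st
      else true) &
      if j is Two then all (fun u => label u <= 1)%N st else true].
  have -> : (if i is Two then all (fun u => all (pred1 1%N) (angles u)) st
      else true) =
      all (fun u => if i is Two then all (pred1 1%N) (angles u) else true) st.
    by case: (i); rewrite // all_predT.
  have -> : (if j is Two then all (fun u => label u <= 1)%N st else true) =
      all (fun u => if j is Two then (label u <= 1)%N else true) st.
    by case: (j); rewrite // all_predT.
  rewrite -!all_predI; apply: eq_all => u /=; rewrite /loc.
  have -> : all angle_ok (angles u) = all (fun n => 0 < n)%N (angles u) &&
      (if i is Two then all (pred1 1%N) (angles u) else true).
    rewrite /angle_ok; case: (i); first by rewrite -all_predI; apply: eq_all.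
    by rewrite andbT; apply: eq_all => n; rewrite /= andbT.
  by case: u => [|a t0 s] /=; rewrite /label_ok ?andbA //; case: (i) (j) => [] [].
set X := if i is Two then _ else _.
set Y := if j is Two then _ else _.
by rewrite -!andbA; do !bool_congr; rewrite andbC -?andbA.
Qed.

Let in_That_posE t : in_That_pos t = all (predI loc pos) (subtrees t).
Proof.
rewrite /in_That_pos in_TE all_predI.
case: t => [|a t s] //=; rewrite -!andbA.
by rewrite [in RHS]/pos /=; do !bool_congr; rewrite andbC -?andbA; do !bool_congr.
Qed.

Let good (s : seq (nat * dtree)) : bool :=
  [&& (0 < size s)%N,
      all (predC is_leaf) (behead (belast Leaf [seq p.2 | p <- s])),
      all angle_ok [seq p.1 | p <- s] &
      all in_That_pos [seq p.2 | p <- s]].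

Let in_T_Node a t s :
  in_T i j (Node a t s) = [&& label_ok a, in_That_pos t & good s].
Proof.
have E (l : seq dtree) : behead (belast t l) = behead (belast Leaf l).
  by case: l.
have H1 : all loc (subtrees t) && all pos (subtrees t) = in_That_pos t.
  by rewrite in_That_posE all_predI.
have H2 : all loc (flatten [seq subtrees p.2 | p <- s])
        && all pos (flatten [seq subtrees p.2 | p <- s])
    = all in_That_pos [seq p.2 | p <- s].
  rewrite -all_predI; elim: s {E} => //= p s <-.
  by rewrite all_cat in_That_posE.
rewrite in_TE /= !all_cat /good -H1 -H2 {1}/loc /= size_map E.
by rewrite -!andbA ltnS; do ?bool_congr.
Qed.

Let add_angle_ok a b : angle_ok a -> angle_ok b -> angle_ok (add_angle i a b).
Proof.
rewrite /angle_ok /add_angle; case: (i) => // /andP[a0 _] _.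
by rewrite addn_gt0 a0.
Qed.

Let normalize_good a u s : angle_ok a -> in_That_pos u ->
    all angle_ok [seq p.1 | p <- s] -> all in_That_pos [seq p.2 | p <- s] ->
  good (normalize i a u s).
Proof.
elim: s a u => [|[b v] s IH] a u ok_a hat_u /=.
  by rewrite /good /= ok_a hat_u.
move=> /andP[ok_b ok_s] /andP[hat_v hat_s].
case: ifPn => [_|nl_u]; first by apply: IH => //; apply: add_angle_ok.
have := IH b v ok_b hat_v ok_s hat_s.
rewrite /good /= ok_a hat_u /=; case: normalize => //= -[c w] l /=.
by rewrite nl_u.
Qed.

Let forest_ok (f : forest) : bool :=
  [&& in_That_pos f.1, all angle_ok [seq p.1 | p <- f.2] &
      all in_That_pos [seq p.2 | p <- f.2]].

Let label_ok0 : label_ok 0. Proof. by rewrite /label_ok; case: j. Qed.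

Let graft_in_T f : forest_ok f -> (f.2 = [::] -> ~~ is_leaf f.1) ->
  in_T i j (graft i f).
Proof.
case: f => t [|[a u] s] /and3P[/= hat_t]; rewrite /graft /=.
  by move=> _ _ /(_ erefl) /negPf nl_t; case/orP: hat_t => [|/andP[]//]; rewrite nl_t.
move=> /andP[ok_a ok_s] /andP[hat_u hat_s] _.
by rewrite in_T_Node label_ok0 hat_t normalize_good.
Qed.

Let degraft_ok t : in_T i j t -> forest_ok (degraft t) /\
  ((degraft t).2 = [::] -> ~~ is_leaf (degraft t).1).
Proof.
case: t => [|[|a] t s] //; last first.
  by move=> Tt; split=> //; rewrite /forest_ok /= andbT /in_That_pos Tt.
rewrite in_T_Node => /and3P[_ hat_t /and4P[s_gt0 _ ok_s hat_s]].
by split; [rewrite /forest_ok /= hat_t ok_s | case: (s) s_gt0].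
Qed.

Let last_ok f : forest_ok f -> in_That_pos (last_tree f).
Proof.
case: f => t s /and3P[/= hat_t _ hat_s]; rewrite /last_tree /=.
have /allP : all in_That_pos (t :: [seq p.2 | p <- s]) by rewrite /= hat_t.
by apply; apply: mem_last.
Qed.

Let glue_ok f w g : forest_ok f -> in_That_pos w -> forest_ok g ->
  forest_ok (glue f w g).
Proof.
case: f => t [|p s] + hat_w; case: g => t' s' + /and3P[/= hat_t' ok_s' hat_s'].
  by rewrite /forest_ok /= hat_w ok_s'.
rewrite /forest_ok /= => /and3P[-> /= ok_s hat_s].
rewrite !map_cat !all_cat /= hat_w ok_s' hat_s' !andbT.
have -> : all in_That_pos [seq q.2 | q <- belast p s].
  apply/allP=> u /mapP[q q_s ->].
  apply: (allP (_ : all in_That_pos [seq q.2 | q <- p :: s])) => //.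
  by apply: (map_f snd); apply: mem_belast.
have ok q : q \in p :: s -> angle_ok q.1.
  have /allP ok1 : all angle_ok [seq r.1 | r <- p :: s] by [].
  by move=> q_s; apply: ok1; apply: (map_f fst q_s).
rewrite ok ?mem_last //= !andbT; apply/allP=> n /mapP[q q_s ->].
by apply: ok; apply: mem_belast.
Qed.

Let in_That (t : dtree) : bool := is_leaf t || in_T i j t.

Let lower_ok t : in_That_pos t -> in_That (lower t).
Proof.
case: t => [|a t s] //; rewrite /in_That_pos /in_That /= !in_T_Node.
by case/andP=> /and3P[+ -> ->] _; rewrite /label_ok !andbT; case: (j) => //; lia.
Qed.

Local Notation F := (freemod k dtree).

Let supp (P : pred dtree) (x : F) : Prop := {in msupp x, forall t, P t}.

Let supp_basis (P : pred dtree) t : P t -> supp P (fbasis t).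
Proof. by move=> Pt u /msupp_fbasis ->. Qed.

Let suppD P x y : supp P x -> supp P y -> supp P (x + y).
Proof.
move=> Px Py t /(fsubsetP (msuppD_le x y)); rewrite inE.
by case/orP=> [/Px|/Py].
Qed.

Let suppZ P c x : supp P x -> supp P (c *: x).
Proof.
move=> Px t; rewrite -mcoeff_neq0 mcoeff_fscale => nz_t; apply: Px.
by rewrite -mcoeff_neq0; apply: contra_neq nz_t => ->; rewrite mulr0.
Qed.

Let supp0 P : supp P 0. Proof. by move=> t; rewrite msupp0. Qed.

Let supp_lin P Q f (x : F) :
  supp P x -> (forall t, P t -> supp Q (f t)) -> supp Q (lin f x).
Proof.
move=> Px Qf; rewrite /lin big_seq.
by apply: big_ind => [||t t_x]; [exact: supp0 | move=> *; exact: suppD |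
  apply/suppZ/Qf/Px].
Qed.

Let supp_bilin P Q R f (x y : F) :
  supp P x -> supp Q y -> (forall t s, P t -> Q s -> supp R (f t s)) ->
  supp R (bilin f x y).
Proof.
move=> Px Qy Rf; apply: supp_lin Px _ => t Pt.
by apply: supp_lin Qy _ => s; apply: Rf.
Qed.

Let in_T_pos (t : dtree) : bool := in_T i j t && (0 < label t)%N.

Let beta_pos t : in_T i j t -> supp in_T_pos (beta_tree lam j t).
Proof.
case: t => // a t s; rewrite in_T_Node => /and3P[ok_a hat_t ok_s] /=.
have ok b : label_ok b -> (0 < b)%N -> in_T_pos (Node b t s).
  by rewrite /in_T_pos in_T_Node hat_t ok_s => -> ->.
rewrite /label_ok in ok_a ok *; case: j ok => ok.
  by apply/suppZ/supp_basis/ok.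
by apply/supp_basis/ok.
Qed.

Lemma beta_tree_in_T t : in_T i j t -> supp (in_T i j) (beta_tree lam j t).
Proof. by move=> Tt u /(beta_pos Tt) /andP[]. Qed.

Let dia_rec_in_T n t s : in_T i j t -> in_T i j s ->
  supp (in_T i j) (dia_rec lam i j n t s).
Proof.
elim: n t s => [|n IH] t s Tt Ts /=; first exact: supp0.
have [ok_t nl_t] := degraft_ok Tt; have [ok_s nl_s] := degraft_ok Ts.
rewrite /dia_step; set f := degraft t in ok_t nl_t *.
set g := degraft s in ok_s nl_s *.
set u := lower (last_tree f); set v := lower (first_tree g).
have hat_u : in_That u by apply/lower_ok/last_ok.
have hat_v : in_That v by apply: lower_ok; case/and3P: ok_s.
pose P w := in_That_pos w && (is_leaf u && is_leaf v || ~~ is_leaf w).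
apply: (supp_lin (P := P)); last first.
  move=> w /andP[hat_w nl_w]; apply/supp_basis/graft_in_T.
    exact: glue_ok.
  rewrite /glue; case E : f.2 => [|p l] //=.
    move=> E'; move: nl_w; rewrite /u /v /last_tree /first_tree E /=.
    by move: (nl_t E) (nl_s E'); case: f.1; case: g.1.
  by case: belast.
have beta_P w : in_T i j w -> supp P (beta_tree lam j w).
  move=> Tw x /(beta_pos Tw)/andP[Tx x0]; rewrite /P /in_That_pos Tx x0 orbT.
  by case: (x) Tx => //= *; rewrite orbT.
case: (u) (v) hat_u hat_v @P beta_P => [|a t' l] [|b s' l'] hat_u hat_v P beta_P.
- apply: (supp_lin (P := is_leaf)); first exact: supp_basis.
  by case=> //= _; apply: supp_basis.
- by apply: (supp_lin (P := in_T i j)) beta_P; apply: supp_basis.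
- by apply: (supp_lin (P := in_T i j)) beta_P; apply: supp_basis.
rewrite /in_That /= in hat_u hat_v.
apply: (supp_lin (P := in_T i j)) beta_P; rewrite [ast_step _ _ _ _ _]/=.
apply: suppD; first apply: suppD.
- by apply: (supp_bilin (beta_tree_in_T hat_u) (supp_basis hat_v)) => *; apply: IH.
- by apply: (supp_bilin (supp_basis hat_u) (beta_tree_in_T hat_v)) => *; apply: IH.
- by apply: suppZ; apply: IH.
Qed.

Lemma diamond_in_T t s : in_T i j t -> in_T i j s ->
  supp (in_T i j) (diamond lam i j t s).
Proof. exact: dia_rec_in_T. Qed.

End Closure.

Section FreeObject.
Context (k : comPzRingType) (lam : k) (i j : tindex).

Definition Bmod : Type := freemod k (Ttree i j).
HB.instance Definition _ := GRing.Lmodule.on Bmod.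

Definition Bemb : Bmod -> freemod k dtree :=
  lin (fun t : Ttree i j => fbasis (tval t)).

(* This drops the trees that are not in T_{i,j}; by [BbetaE] and [BmulE],     *)
(* none occur in its uses below.                                              *)
Definition Brestr : freemod k dtree -> Bmod :=
  lin (fun t => if insub t is Some u then fbasis (u : Ttree i j) else 0).

Definition Bmul : Bmod -> Bmod -> Bmod :=
  bilin (fun t s : Ttree i j => Brestr (diamond lam i j (tval t) (tval s))).

Definition Bbeta : Bmod -> Bmod :=
  lin (fun t : Ttree i j => Brestr (beta_tree lam j (tval t))).

Fact Ytree_subproof : in_T i j (Node 0 Leaf [:: (1%N, Leaf)]).
Proof. by case: i; case: j. Qed.

Definition Ytree : Ttree i j := TTree Ytree_subproof.

Lemma BrestrK x : {in msupp x, forall t, in_T i j t} -> Bemb (Brestr x) = x.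
Proof.
move=> Tx; rewrite {2}[x]monalgE [Brestr x]/lin /Bemb raddf_sum /=.
apply: eq_big_seq => t /Tx Tt; rewrite linearZ /= insubT lin_fbasis.
by apply/malgP=> u; rewrite mcoeff_fscale !mcoeffU mulrnAr mulr1.
Qed.

Lemma BbetaE t : Bemb (Bbeta (fbasis t)) = beta_tree lam j (tval t).
Proof.
by rewrite /Bbeta lin_fbasis BrestrK //; apply/beta_tree_in_T/tvalP.
Qed.

Lemma BmulE t s :
  Bemb (Bmul (fbasis t) (fbasis s)) = diamond lam i j (tval t) (tval s).
Proof.
rewrite /Bmul /bilin !lin_fbasis BrestrK //.
by apply: diamond_in_T; apply: tvalP.
Qed.

End FreeObject.

(* The categories B^lam_{i,j}: their objects are the [A : alg_data k] such    *)
(* that [is_object lam i j A].                                                *)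
Record alg_data (k : comPzRingType) := AlgData {
  carrier :> lmodType k;
  amul : carrier -> carrier -> carrier;
  apoint : carrier;
  aop : carrier -> carrier
}.

Section Category.
Context (k : comPzRingType).
Implicit Types (lam : k) (i j : tindex) (A B : alg_data k).

(* Associative, not necessarily unital. *)
Definition is_algebra (V : lmodType k) (mul : V -> V -> V) : Prop :=
  [/\ forall a, linear (mul a), forall b, linear (mul^~ b) & associative mul].

Definition is_Baxter_operator lam (V : lmodType k) (mul : V -> V -> V)
    (beta : V -> V) : Prop :=
  linear beta /\ forall a b, mul (beta a) (beta b) =
    beta (mul (beta a) b + mul a (beta b) + lam *: mul a b).

Definition is_object lam i j A : Prop :=
  [/\ is_algebra (@amul k A),
      is_Baxter_operator lam (@amul k A) (@aop k A),
      i = Two -> amul (apoint A) (apoint A) = apoint A &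
      j = Two -> forall a : A, aop (aop a) = - lam *: aop a].

Definition is_morphism A B (f : A -> B) : Prop :=
  [/\ linear f, {morph f : a b / amul a b >-> amul a b},
      f (apoint A) = apoint B & forall a, f (aop a) = aop (f a)].

Definition is_initial_object lam i j A : Prop :=
  is_object lam i j A /\
  forall B, is_object lam i j B ->
    exists f : A -> B, is_morphism f /\
      forall g : A -> B, is_morphism g -> g =1 f.

End Category.

Definition Btriple (k : comPzRingType) (lam : k) (i j : tindex) : alg_data k :=
  AlgData (@Bmul k lam i j) (fbasis (Ytree i j)) (@Bbeta k lam i j).

(* Main.v *)
Require Import Defs.
From mathcomp Require Import all_boot all_order all_algebra.
From mathcomp Require Import finmap ring zify.
From mathcomp.multinomials Require Import monalg.

(** Read a tree of root label 0 as a word: its children are the letters (a leaf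
    being the empty letter) and each angle is a power of Y between two of them.
    A letter other than the leaf has a positive root label, so it lies in the
    image of beta, and normalization removes the empty inner letters.  The
    product of two words is their concatenation, in which the two letters that
    meet are multiplied by the Baxter identity.

    Why B is an object.  Write u * v for the auxiliary product, so that
    u * v = beta(u) v + u beta(v) + lam u v, with the leaf as its unit.  The
    product of two letters t and s is by definition beta(t' * s'), where t' and
    s' are t and s with lowered labels.  For j = 2 this is the Baxter identity
    for trees of root label 0 only, and [Baxter_tree] derives the other cases
    from beta^2 = - lam beta.  Associativity ([dia_assoc]) is by induction on
    the weight.  If the middle factor has at least two letters, empty ones
    included, the two multiplications modify distinct letters of it and commute
    ([dia_assoc_split]).  If it is a single letter, everything happens at one
    letter, and associativity there is beta applied to the associativity of *
    on lowered letters ([dia_assoc_single]).  The latter holds because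
    (u * v) * w and u * (v * w) expand, by the Baxter identity, into the same
    seven products of three trees; in each of them at least one letter was
    lowered and not raised again, so the induction hypothesis applies
    ([ast_assoc]).

    Why B is initial.  In an object A with a unit adjoined, a word has a value
    [ev], where the leaf has the value 1 and each unit of a root label is one
    application of the operator.  It is multiplicative, by the recursion that
    defines the product ([ev_mul]), and the values of the trees of T lie in A
    ([aug_ev]); this gives a morphism ([Beval_morphism]).  It is the only one
    because every tree is obtained from Y by beta and products: the letters and
    the single factors Y of a word can be split off one by one from the left
    ([generated_by_Y]). *)

Set Implicit Arguments.
Unset Strict Implicit.
Unset Printing Implicit Defensive.

Import GRing.Theory.
Local Open Scope ring_scope.

(** * Linear extensions *)

Section LinTheory.
Context (k : comPzRingType).

Lemma lin_fbasis_id (T : choiceType) (x : freemod k T) : x = lin fbasis x.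
Proof.
rewrite {1}[x]monalgE /lin; apply: eq_bigr => t _.
by apply/malgP=> u; rewrite mcoeff_fscale !mcoeffU mulrnAr mulr1.
Qed.

Lemma linear_lin (T : choiceType) (V W : lmodType k) (h : V -> W)
    (f : T -> V) (x : freemod k T) :
  linear h -> h (lin f x) = lin (h \o f) x.
Proof.
move=> lin_h.
have h0 : h 0 = 0.
  by have := lin_h (-1) 0 0; rewrite scaler0 addr0 scaleN1r addNr.
have hZ c v : h (c *: v) = c *: h v.
  by have := lin_h c v 0; rewrite !addr0 h0 addr0.
have hD u v : h (u + v) = h u + h v.
  by have := lin_h 1 u v; rewrite !scale1r.
rewrite /lin; elim/big_ind2: _ => [//|a b c d <- <-|t _]; first by rewrite hD.
by rewrite hZ.
Qed.

Lemma linear_ext (T : choiceType) (W : lmodType k) (h h' : freemod k T -> W) :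
  linear h -> linear h' -> (forall t, h (fbasis t) = h' (fbasis t)) -> h =1 h'.
Proof.
move=> lin_h lin_h' e x; rewrite (lin_fbasis_id x) !linear_lin //.
by apply: eq_lin => t _ /=.
Qed.

Section Lin.
Context (T : choiceType) (V : lmodType k).
Implicit Types (f g : T -> V) (x y : freemod k T).

Lemma linD f x y : lin f (x + y) = lin f x + lin f y.
Proof. by rewrite raddfD. Qed.

Lemma linZ f c x : lin f (c *: x) = c *: lin f x.
Proof. by rewrite linearZ. Qed.

Lemma lin_addf f g x : lin (fun t => f t + g t) x = lin f x + lin g x.
Proof. by rewrite /lin -big_split; apply: eq_bigr => t _; rewrite scalerDr. Qed.

Lemma lin_scalef c f x : lin (fun t => c *: f t) x = c *: lin f x.
Proof.
rewrite /lin scaler_sumr; apply: eq_bigr => t _.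
by rewrite !scalerA mulrC.
Qed.

End Lin.

Lemma lin_lin (S T : choiceType) (V : lmodType k) (f : T -> V)
    (g : S -> freemod k T) x :
  lin f (lin g x) = lin (fun s => lin f (g s)) x.
Proof. by rewrite linear_lin //; apply: linearP. Qed.

Lemma exchange_lin (S T : choiceType) (V : lmodType k) (f : S -> T -> V) x y :
  lin (fun s => lin (f s) y) x = lin (fun t => lin (f^~ t) x) y.
Proof.
rewrite /lin; under eq_bigr do rewrite scaler_sumr.
rewrite exchange_big; apply: eq_bigr => t _; rewrite scaler_sumr.
by apply: eq_bigr => s _; rewrite !scalerA mulrC.
Qed.

Section Bilin.
Context (S T : choiceType) (V : lmodType k) (f : S -> T -> V).

Lemma bilinl_linear y : linear (fun x => bilin f x y).
Proof. by move=> c x x'; rewrite /bilin linearP. Qed.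

Lemma bilinr_linear x : linear (bilin f x).
Proof.
move=> c y y'; rewrite /bilin -lin_scalef -lin_addf.
by apply: eq_lin => t _; rewrite linearP.
Qed.

Lemma bilinDl x x' y : bilin f (x + x') y = bilin f x y + bilin f x' y.
Proof. by rewrite /bilin linD. Qed.

Lemma bilinDr x y y' : bilin f x (y + y') = bilin f x y + bilin f x y'.
Proof. by have := bilinr_linear x 1 y y'; rewrite !scale1r. Qed.

Lemma bilinZl c x y : bilin f (c *: x) y = c *: bilin f x y.
Proof. by rewrite /bilin linZ. Qed.

Lemma bilinZr c x y : bilin f x (c *: y) = c *: bilin f x y.
Proof.
by rewrite /bilin -lin_scalef; apply: eq_lin => t _; rewrite linZ.
Qed.

Lemma bilin_linl (U : choiceType) (g : U -> freemod k S) x y :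
  bilin f (lin g x) y = lin (fun u => bilin f (g u) y) x.
Proof. exact: (linear_lin _ _ (bilinl_linear y)). Qed.

Lemma bilin_linr (U : choiceType) (g : U -> freemod k T) x y :
  bilin f x (lin g y) = lin (fun u => bilin f x (g u)) y.
Proof. exact: (linear_lin _ _ (bilinr_linear x)). Qed.

Lemma bilin_fbasis s t : bilin f (fbasis s) (fbasis t) = f s t.
Proof. by rewrite /bilin !lin_fbasis. Qed.

End Bilin.

Lemma bilinEl (S T : choiceType) (V : lmodType k) (f : S -> T -> V) x t :
  bilin f x (fbasis t) = lin (f^~ t) x.
Proof. by apply: eq_lin => s _; rewrite lin_fbasis. Qed.

Lemma bilinEr (S T : choiceType) (V : lmodType k) (f : S -> T -> V) s y :
  bilin f (fbasis s) y = lin (f s) y.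
Proof. by rewrite /bilin lin_fbasis. Qed.

(** The identities below hold for the trees of T_{i,j} but not for arbitrary
    elements of [dtree]; this predicate carries the restriction through linear
    combinations. *)
Definition supported (T : choiceType) (P : pred T) (x : freemod k T) : Prop :=
  {in msupp x, forall t, P t}.

Section Supported.
Context (T : choiceType).
Implicit Types (P Q : pred T) (x y : freemod k T).

Lemma supported_fbasis P t : P t -> supported P (fbasis t : freemod k T).
Proof. by move=> Pt u /msupp_fbasis ->. Qed.

Lemma supportedD P x y : supported P x -> supported P y -> supported P (x + y).
Proof.
by move=> Px Py t /(fsubsetP (msuppD_le x y)); rewrite inE => /orP[/Px|/Py].
Qed.

Lemma supportedZ P c x : supported P x -> supported P (c *: x).
Proof.
move=> Px t; rewrite -mcoeff_neq0 mcoeff_fscale => nz_t; apply: Px.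
by rewrite -mcoeff_neq0; apply: contra_neq nz_t => ->; rewrite mulr0.
Qed.

Lemma supported_lin (S : choiceType) P (Q : pred S) (f : S -> freemod k T)
    (x : freemod k S) :
  supported Q x -> (forall s, Q s -> supported P (f s)) ->
  supported P (lin f x).
Proof.
move=> Qx Pf; rewrite /lin big_seq; apply: big_ind.
- by move=> t; rewrite msupp0.
- by move=> *; apply: supportedD.
- by move=> s /Qx Qs; apply/supportedZ/Pf.
Qed.

Lemma eq_supported_lin (V : lmodType k) P (f g : T -> V) x :
  supported P x -> (forall t, P t -> f t = g t) -> lin f x = lin g x.
Proof. by move=> Px fg; apply: eq_lin => t /Px /fg. Qed.

End Supported.

End LinTheory.

(** * The trees of T_{i,j}, node by node *)

Section Validity.
Context (i j : tindex).

Definition angle_ok (n : nat) : bool :=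
  (0 < n)%N && (if i is Two then n == 1%N else true).

Definition label_ok (n : nat) : bool := if j is Two then (n <= 1)%N else true.

Definition branches (s : seq (nat * dtree)) : seq dtree := [seq p.2 | p <- s].

(** Only the condition on positive labels exempts the root; it is kept apart as
    [pos]. *)
Let node_ok (u : dtree) : bool :=
  is_leaf u || [&& (1 < size (children u))%N,
    all (predC is_leaf) (inner (children u)), all angle_ok (angles u) &
    label_ok (label u)].

Let pos (u : dtree) : bool := is_leaf u || (0 < label u)%N.

Let in_TE t : in_T i j t =
  [&& ~~ is_leaf t, all node_ok (subtrees t) & all pos (proper_subtrees t)].
Proof.
rewrite /in_T /in_Tinfty; case: (is_leaf t) => //=.
have E : node_ok =1 predI (predI (predI (predI
    (fun u => is_leaf u || (1 < size (children u))%N)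
    (fun u => all (predC is_leaf) (inner (children u))))
    (fun u => all (fun n => 0 < n)%N (angles u)))
    (fun u => if i is Two then all (pred1 1%N) (angles u) else true))
    (fun u => if j is Two then (label u <= 1)%N else true).
  have all_angle l : all angle_ok l = all (fun n => 0 < n)%N l &&
      (if i is Two then all (pred1 1%N) l else true).
    by rewrite /angle_ok; elim: l => [|n l /= ->]; case: (i) => //=;
      rewrite ?andbT //; case: (0 < n)%N => //=; rewrite andbCA.
  case=> [|a t0 s]; first by case: (i) (j) => [] [].
  by rewrite /node_ok /= all_angle /label_ok !andbA.
rewrite (eq_all E) !all_predI.
have -> : all (fun u => if i is Two then all (pred1 1%N) (angles u) else true)
      (subtrees t) =
    (if i is Two then all (fun u => all (pred1 1%N) (angles u)) (subtrees t)
    else true).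
  by case: (i); rewrite ?all_predT.
have -> : all (fun u => if j is Two then (label u <= 1)%N else true)
      (subtrees t) =
    (if j is Two then all (fun u => label u <= 1)%N (subtrees t) else true).
  by case: (j); rewrite ?all_predT.
set b5 := if i is Two then _ else _; set b6 := if j is Two then _ else _.
set b1 := all _ _; set b2 := all _ _; set b3 := all pos _; set b4 := all _ _.
by case: b1 b2 b3 b4 b5 b6 => [] [] [] [] [] [].
Qed.

Let in_That_posE t : in_That_pos i j t = all (predI node_ok pos) (subtrees t).
Proof.
rewrite /in_That_pos in_TE all_predI; case: t => [//|a t s] /=.
rewrite [in RHS]/pos /=; set b1 := node_ok _; set b2 := all _ _.
by set b3 := all _ _; case: b1 b2 b3 (0 < a)%N => [] [] [] [].
Qed.

(** This turns the definition of T_{i,j}, which quantifies over all subtrees,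
    into a recursive one: the children are leaves or trees of T_{i,j} with a
    positive root label. *)
Lemma in_T_Node a t s :
  in_T i j (Node a t s) =
    [&& label_ok a, s != [::], all angle_ok [seq p.1 | p <- s],
        all (predC is_leaf) (behead (belast Leaf (branches s))),
        in_That_pos i j t & all (in_That_pos i j) (branches s)].
Proof.
rewrite in_TE /= !all_cat.
have childrenE : all node_ok (subtrees t)
      && all node_ok (flatten [seq subtrees p.2 | p <- s])
      && (all pos (subtrees t)
      && all pos (flatten [seq subtrees p.2 | p <- s])) =
    in_That_pos i j t && all (in_That_pos i j) (branches s).
  rewrite andbACA -!all_predI in_That_posE; congr (_ && _).
  by elim: s => //= p s <-; rewrite all_cat in_That_posE.
rewrite -childrenE {1}/node_ok /= size_map ltnS lt0n size_eq0.
set b1 := label_ok a; set b2 := s != [::]; set b3 := all _ [seq p.1 | p <- s].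
have -> : behead (belast t (branches s)) = behead (belast Leaf (branches s)).
  by case: (branches s).
set b4 := all _ _; set b5 := all _ (subtrees t); set b6 := all _ (flatten _).
by case: b1 b2 b3 b4 b5 b6 => [] [] [] [] [] []; rewrite /= ?andbF.
Qed.

End Validity.

(** * Gluing and normalizing forests *)

Section Forests.
Context (i : tindex).
Implicit Types (t u v w : dtree) (s l : seq (nat * dtree)) (f g h q : forest).

Lemma add_angleA : associative (add_angle i).
Proof. by rewrite /add_angle => a b c; case: (i); rewrite ?addnA. Qed.

Definition norm l : seq (nat * dtree) :=
  if l is (a, u) :: s then normalize i a u s else [::].

Lemma norm_consP a u s : exists p s', norm ((a, u) :: s) = p :: s'.
Proof.
elim: s a u => [|[b v] s IH] a u /=; first by exists (a, u), [::].
by case: is_leaf; [apply: IH | exists (a, u), (normalize i b v s)].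
Qed.

Lemma norm_eq0 l : (norm l == [::]) = (l == [::]).
Proof. by case: l => [//|[a u] s]; have [p [s' ->]] := norm_consP a u s. Qed.

Lemma norm_idem l : norm (norm l) = norm l.
Proof.
case: l => [//|[a u] s]; elim: s a u => [//|[b v] s IH] a u /=.
case: ifP => leaf_u; first exact: IH.
have := IH b v; have [[c x] [s' /= ->]] := norm_consP b v s.
by rewrite /= leaf_u => ->.
Qed.

(** Normalizing the end of a word first does not change the normal form of the
    whole; the angles that are merged in another order are handled by the
    associativity of their addition. *)
Lemma norm_cons p l : norm (p :: norm l) = norm (p :: l).
Proof.
case: p => a u; case: l => [//|[b v] s].
case leaf_u: (is_leaf u); last first.
  have := norm_idem ((b, v) :: s).
  by have [[c x] [s' /= ->]] := norm_consP b v s; rewrite /= leaf_u => ->.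
elim: s b v => [//|[c x] s IH] b v.
case leaf_v: (is_leaf v).
  have := IH (add_angle i b c) x; rewrite /= leaf_u leaf_v => ->.
  by rewrite add_angleA.
have := norm_idem ((c, x) :: s); have [[d y] [s' /=]] := norm_consP c x s.
by move=> E; rewrite /= leaf_v E /= leaf_u leaf_v => ->.
Qed.

Lemma norm_cat s l : norm (s ++ norm l) = norm (s ++ l).
Proof.
elim: s => [|p s IH] /=; first exact: norm_idem.
by rewrite -[LHS]norm_cons IH norm_cons.
Qed.

Definition splice l w s : seq (nat * dtree) :=
  if l is p :: l' then belast p l' ++ ((last p l').1, w) :: s else [::].

(** The last tree is never removed by normalization, so it may be replaced
    before or after. *)
Lemma norm_splice l w s : norm (splice (norm l) w s) = norm (splice l w s).
Proof.
case: l => [//|[a u] l]; elim: l a u => [//|[b v] l IH] a u.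
case leaf_u: (is_leaf u).
  have := IH (add_angle i a b) v; rewrite /= leaf_u => ->.
  by case: (l) => [|p l'] /=; rewrite leaf_u.
have := IH b v; have [p [l' E]] := norm_consP b v l.
rewrite E -[splice ((a, u) :: _) _ _]/((a, u) :: splice ((b, v) :: l) w s).
move=> IHbv; rewrite -[RHS]norm_cons -IHbv norm_cons.
by rewrite /= leaf_u -/(norm ((b, v) :: l)) E.
Qed.

Lemma last_norm t l :
  last t [seq p.2 | p <- norm l] = last t [seq p.2 | p <- l].
Proof.
case: l => [//|[a u] l]; elim: l t a u => [//|[b v] l IH] t a u /=.
by case: ifP => _ /=; rewrite IH.
Qed.

Lemma graftE f : f.2 != [::] -> graft i f = Node 0 f.1 (norm f.2).
Proof. by case: f => t [|[a u] s]. Qed.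

(** The forests that [degraft] recovers from their grafting, up to
    normalization: a single tree of label 0 is cut into pieces instead. *)
Definition graft_stable f : bool := (f.2 != [::]) || (0 < label f.1)%N.

Definition normf f : forest := (f.1, norm f.2).

Lemma degraft_graft f : graft_stable f -> degraft (graft i f) = normf f.
Proof. by case: f => [[|[|a] t s] [|[b u] l]]. Qed.

Lemma last_tree_normf f : last_tree (normf f) = last_tree f.
Proof. exact: last_norm. Qed.

Lemma splice_neq0 l w s : l != [::] -> splice l w s != [::].
Proof. by case: l => //= p l _; case: belast. Qed.

Lemma glueE f w g : f.2 != [::] -> glue f w g = (f.1, splice f.2 w g.2).
Proof. by case: f => t [|p l]. Qed.

Lemma graft_glue_normfl f w g :
  graft i (glue (normf f) w g) = graft i (glue f w g).
Proof.
have [nil_f|f_neq0] := eqVneq f.2 [::]; first by case: f nil_f => t s /= ->.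
have normf_neq0 : (normf f).2 != [::] by rewrite /= norm_eq0.
rewrite !glueE // !graftE ?splice_neq0 // /normf.
by congr Node; apply: norm_splice.
Qed.

Lemma graft_glue_normfr f w g :
  graft i (glue f w (normf g)) = graft i (glue f w g).
Proof.
case: f => t [|p l].
  have [nil_g|g_neq0] := eqVneq g.2 [::]; first by case: g nil_g => u s /= ->.
  by rewrite !graftE ?norm_eq0 //; congr Node; apply: norm_idem.
rewrite !glueE // !graftE ?splice_neq0 //.
by rewrite /splice /= -!cat_rcons; congr Node; apply: norm_cat.
Qed.

Lemma splice_cat s l w s' :
  l != [::] -> splice (s ++ l) w s' = s ++ splice l w s'.
Proof.
by move=> l_neq0; elim: s => //= p s <-; case: s => [|p' s] //=; case: l l_neq0.
Qed.

(** When the middle forest has at least two trees, the gluings at its two ends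
    do not interact. *)
Lemma glueA f w g w' h :
  g.2 != [::] -> glue (glue f w g) w' h = glue f w (glue g w' h).
Proof.
case: f g => t [|p l] [u [//|p' l']] _; first by [].
rewrite [glue (t, _) w _]glueE // !glueE ?splice_neq0 //; congr pair.
transitivity
  (splice (belast p l ++ ((last p l).1, w) :: p' :: l') w' h.2) => //.
by rewrite -cat_rcons splice_cat // cat_rcons.
Qed.

Lemma glue_single_absorb f w v w' h :
  glue (glue f w (v, [::])) w' h = glue f w' h.
Proof.
case: f => t [//|p l]; rewrite !glueE ?splice_neq0 //.
transitivity
  ((t, splice (belast p l ++ [:: ((last p l).1, w)]) w' h.2) : forest) => //.
by rewrite splice_cat.
Qed.

Lemma last_tree_glue f w g :
  last_tree (glue f w g) = if g.2 is [::] then w else last_tree g.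
Proof.
case: f g => t [|p l] [u [|p' l']] //; rewrite /last_tree /=;
  by rewrite map_cat last_cat.
Qed.

Lemma first_tree_glue f w g :
  first_tree (glue f w g) = if f.2 is [::] then w else first_tree f.
Proof. by case: f => t [|p l]. Qed.

End Forests.

(** * The Baxter identity *)

Section Operator.
Context (k : comPzRingType) (lam : k) (i j : tindex).
Implicit Types (t u v w : dtree).

Local Notation F := (freemod k dtree).
Local Notation "'beta'" := (beta_tree lam j).
Local Notation "'dia'" := (diamond lam i j).
Local Notation "'star'" := (ast lam i j).

(** The tree in beta(t) without its scalar [bcoef]; separating the two lets the
    cases j = 2 and j = oo share their proofs. *)
Definition raise t : dtree :=
  if t is Node a t0 s then Node (if j is Two then 1 else a.+1) t0 s else Leaf.

Definition bcoef t : k := if j is Two then (- lam) ^+ label t else 1.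

(** The recursion for the product of two raised trees only sees their bases.
    For j = oo the base of t is t; for j = 2 it is t with root label 0. *)
Definition base t : dtree := lower (raise t).

Lemma beta_treeE t : beta t = bcoef t *: fbasis (raise t).
Proof.
by rewrite /bcoef; case: t => [|a t s] /=; case: j; rewrite ?expr0 ?scale1r.
Qed.

Lemma raise_base t : raise (base t) = raise t.
Proof. by rewrite /base /raise; case: t => [|a t s] //=; case: j. Qed.

Lemma bcoef_base t : bcoef (base t) = 1.
Proof.
by rewrite /bcoef /base /raise; case: t => [|a t s] /=; case: j;
  rewrite ?expr0.
Qed.

Lemma beta_base t : beta t = bcoef t *: beta (base t).
Proof.
by rewrite [in RHS]beta_treeE raise_base bcoef_base scale1r -beta_treeE.
Qed.

Lemma label_raise t : ~~ is_leaf t -> (0 < label (raise t))%N.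
Proof. by rewrite /raise; case: t => // a t s _; case: j. Qed.

Lemma is_leaf_lower t : is_leaf (lower t) = is_leaf t.
Proof. by case: t. Qed.

Lemma in_T_label_ok t : in_T i j t -> label_ok j (label t).
Proof. by case: t => // a t s; rewrite in_T_Node => /andP[]. Qed.

Lemma in_T_nonleaf t : in_T i j t -> ~~ is_leaf t.
Proof. by case: t. Qed.

Lemma in_T_relabel a b t s :
  label_ok j b -> in_T i j (Node a t s) -> in_T i j (Node b t s).
Proof. by rewrite !in_T_Node => -> /andP[]. Qed.

Lemma label_okW a b : (a <= b)%N -> label_ok j b -> label_ok j a.
Proof.
by rewrite /label_ok; case: j => // le_ab; apply: leq_trans.
Qed.

Lemma base_in_T t : in_T i j t -> in_T i j (base t).
Proof.
case: t => // a t s Tt; apply: in_T_relabel (Tt).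
by have := in_T_label_ok Tt; rewrite /label_ok /=; case: j.
Qed.

Definition in_That t : bool := is_leaf t || in_T i j t.

Lemma lower_in_That t : in_That_pos i j t -> in_That (lower t).
Proof.
case: t => [//|a t s] /andP[Tt _]; apply: in_T_relabel (Tt).
by apply: label_okW (in_T_label_ok Tt); exact: leq_pred.
Qed.

Lemma in_T_pos_hat t : in_T i j t -> (0 < label t)%N -> in_That_pos i j t.
Proof. by rewrite /in_That_pos => -> ->; rewrite orbT. Qed.

(** For j = 2 a positive label is 1, so that it is lowered to 0 and the scalar
    (- lam)^0 is 1. *)
Lemma beta_lower t : in_That_pos i j t -> beta (lower t) = fbasis t.
Proof.
case: t => [//|[|a] t s] /andP[Tt //= _].
have := in_T_label_ok Tt; rewrite /label_ok; case: j => //.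
by case: a Tt => // Tt _; rewrite expr0 scale1r.
Qed.

Lemma raise_lower t : in_That_pos i j t -> raise (lower t) = t.
Proof.
case: t => [//|[|a] t s] /andP[Tt //= _]; rewrite /raise /=.
by have := in_T_label_ok Tt; rewrite /label_ok; case: j => //; case: a Tt.
Qed.

Lemma last_tree_pos t :
  in_T i j t -> in_That_pos i j (last_tree (degraft t)).
Proof.
case: t => // [[|a]] t s Tt; last exact: in_T_pos_hat.
move: Tt; rewrite in_T_Node /last_tree /= => /and5P[_ _ _ _ /andP[pos_t pos_s]].
by apply: (allP (_ : all _ (t :: branches s)));
  [rewrite /= pos_t | apply: mem_last].
Qed.

Lemma first_tree_pos t :
  in_T i j t -> in_That_pos i j (first_tree (degraft t)).
Proof.
case: t => // [[|a]] t s Tt; last exact: in_T_pos_hat.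
by move: Tt; rewrite in_T_Node => /and5P[_ _ _ _ /andP[]].
Qed.

Lemma degraft_single t : in_T i j t -> (degraft t).2 = [::] ->
  degraft t = (t, [::]) /\ (0 < label t)%N.
Proof.
case: t => // [[|a]] t s //.
by rewrite in_T_Node => /and3P[_ /= + _] s0; rewrite s0.
Qed.

Lemma ast_nonleaf u v : ~~ is_leaf u -> ~~ is_leaf v ->
  star u v = bilin dia (beta u) (fbasis v) + bilin dia (fbasis u) (beta v)
             + lam *: dia u v.
Proof. by rewrite astE => /negPf-> /negPf->. Qed.

Lemma ast_leafl v : star Leaf v = fbasis v.
Proof. by []. Qed.

Lemma ast_leafr u : star u Leaf = fbasis u.
Proof. by case: u. Qed.

Lemma bilin_dia_in_T x y : supported (in_T i j) x -> supported (in_T i j) y ->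
  supported (in_T i j) (bilin dia x y).
Proof.
move=> Tx Ty; apply: supported_lin Tx _ => u Tu.
by apply: supported_lin Ty _ => v Tv; apply: diamond_in_T.
Qed.

Lemma ast_in_T u v : in_T i j u -> in_T i j v ->
  supported (in_T i j) (star u v).
Proof.
move=> Tu Tv; rewrite ast_nonleaf ?in_T_nonleaf //.
apply: supportedD; first apply: supportedD; last exact/supportedZ/diamond_in_T.
  by apply: bilin_dia_in_T; [apply: beta_tree_in_T | apply: supported_fbasis].
by apply: bilin_dia_in_T; [apply: supported_fbasis | apply: beta_tree_in_T].
Qed.

Lemma degraft_pos t : (0 < label t)%N -> degraft t = (t, [::]).
Proof. by case: t => // [[]]. Qed.

Lemma dia_raise u v : ~~ is_leaf u -> ~~ is_leaf v ->
  dia (raise u) (raise v) = lin beta (star (base u) (base v)).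
Proof.
move=> u_nl v_nl; rewrite diamondE !degraft_pos ?label_raise //.
by rewrite [RHS]lin_fbasis_id.
Qed.

Lemma dia_beta u v : ~~ is_leaf u -> ~~ is_leaf v ->
  bilin dia (beta u) (beta v) =
    (bcoef u * bcoef v) *: lin beta (star (base u) (base v)).
Proof.
move=> u_nl v_nl; rewrite [beta u]beta_treeE [beta v]beta_treeE.
by rewrite bilinZl bilinZr scalerA bilin_fbasis dia_raise.
Qed.

Lemma beta_beta t : j = Two -> ~~ is_leaf t ->
  lin beta (beta t) = - lam *: beta t.
Proof.
move=> j2; case: t => // a t s _; set u := Node a t s.
rewrite [beta u]beta_treeE linZ lin_fbasis beta_treeE !scalerA mulrC.
by rewrite {1}/bcoef /u /raise j2.
Qed.

(** For j = oo this is the definition of the product of two raised trees.  For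
    j = 2 the definition computes beta(base u * base v) instead, up to scalars.
    If u has label 1, then u = beta(base u) and beta(u) = - lam u; hence u * v
    is already a multiple of the product of the raised trees, that is of
    beta(base u * base v), and applying beta to it multiplies it by - lam. *)
Lemma Baxter_tree u v : in_T i j u -> in_T i j v ->
  bilin dia (beta u) (beta v) = lin beta (star u v).
Proof.
move=> Tu Tv; have [nl_u nl_v] := (in_T_nonleaf Tu, in_T_nonleaf Tv).
rewrite dia_beta //.
have [jinf|j2] : j = Infty \/ j = Two by case: j; [right | left].
  rewrite /bcoef /base /raise jinf mulr1 scale1r.
  by case: (u) (v) nl_u nl_v => [//|a t s] [].
have coef1 t : t = base t -> bcoef t = 1 by move->; apply: bcoef_base.
have coefN t : ~~ is_leaf t -> t = raise t -> bcoef t = - lam.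
  by rewrite /bcoef /raise j2; case: t => // a t s _ ->.
have cases t : in_T i j t -> t = base t \/ t = raise t.
  move=> Tt; have := in_T_label_ok Tt; rewrite /label_ok /base /raise j2.
  by case: t Tt => // [[|[]]] // t s _ _; [left | right].
have E : lin beta (lin beta (star (base u) (base v))) =
    - lam *: lin beta (star (base u) (base v)).
  rewrite lin_lin -lin_scalef; apply: eq_supported_lin; last first.
    by move=> t; apply: beta_beta.
  by move=> t /(ast_in_T (base_in_T Tu) (base_in_T Tv)); apply: in_T_nonleaf.
have ast_uv : star u v =
    bcoef u *: dia (raise u) v + bcoef v *: dia u (raise v) + lam *: dia u v.
  by rewrite ast_nonleaf // !beta_treeE bilinZl bilinZr !bilin_fbasis.
have := dia_raise nl_u nl_v => R.
case: (cases u Tu) (cases v Tv) => [] eu [] ev.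
(* The four cases are the root labels 0 or 1 of u and of v. *)
- by rewrite (coef1 u eu) (coef1 v ev) mulr1 scale1r -eu -ev.
- rewrite (coef1 u eu) (coefN v nl_v ev) mul1r -E ast_uv.
  rewrite (coef1 u eu) (coefN v nl_v ev).
  by rewrite -ev scale1r scaleNr addrNK {2}ev R.
- rewrite (coefN u nl_u eu) (coef1 v ev) mulr1 -E ast_uv.
  rewrite (coefN u nl_u eu) (coef1 v ev).
  by rewrite -eu scale1r addrAC scaleNr addNr add0r {2}eu R.
rewrite ast_uv (coefN u nl_u eu) (coefN v nl_v ev) -eu -ev -addrA -scalerDl.
by rewrite addNr scale0r addr0 linZ {2}eu {2}ev R E scalerA.
Qed.

End Operator.

(** * Associativity *)

Section Associativity.
Context (k : comPzRingType) (lam : k) (i j : tindex).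
Implicit Types (t u v w : dtree).

Local Notation F := (freemod k dtree).
Local Notation "'beta'" := (beta_tree lam j).
Local Notation "'dia'" := (diamond lam i j).
Local Notation "'star'" := (ast lam i j).
Local Notation "'raise'" := (raise j).

(** The recursion for the product lowers the trees of beta(x) one by one.  For
    j = 2 this does not restore x, but it does so under beta, by the Baxter
    identity. *)
Lemma beta_ast_lowerl x v : in_T i j x -> in_That i j v ->
  lin (fun w => lin beta (star (lower w) v)) (beta x) = lin beta (star x v).
Proof.
move=> Tx; rewrite beta_treeE linZ lin_fbasis -/(base j x).
have [nl_x nl_bx] := (in_T_nonleaf Tx, in_T_nonleaf (base_in_T Tx)).
case/orP=> [|Tv].
  by case: v => // _; rewrite !ast_leafr !lin_fbasis -beta_base.
by rewrite -!Baxter_tree ?base_in_T // [beta x]beta_base bilinZl.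
Qed.

Lemma beta_ast_lowerr x v : in_T i j x -> in_That i j v ->
  lin (fun w => lin beta (star v (lower w))) (beta x) = lin beta (star v x).
Proof.
move=> Tx; rewrite beta_treeE linZ lin_fbasis -/(base j x).
have [nl_x nl_bx] := (in_T_nonleaf Tx, in_T_nonleaf (base_in_T Tx)).
case/orP=> [|Tv].
  by case: v => // _; rewrite !ast_leafl !lin_fbasis -beta_base.
by rewrite -!Baxter_tree ?base_in_T // [beta x]beta_base bilinZr.
Qed.

Lemma bilin_ast x y : supported (in_T i j) x -> supported (in_T i j) y ->
  bilin star x y = bilin dia (lin beta x) y + bilin dia x (lin beta y)
                   + lam *: bilin dia x y.
Proof.
move=> Tx Ty.
have E u : in_T i j u -> lin (star u) y = bilin dia (beta u) y +
    bilin dia (fbasis u) (lin beta y) + lam *: bilin dia (fbasis u) y.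
  move=> Tu; rewrite [in RHS](lin_fbasis_id y) lin_lin.
  rewrite !bilin_linr -lin_scalef -!lin_addf.
  apply: eq_supported_lin Ty _ => v Tv.
  rewrite ast_nonleaf ?(in_T_nonleaf Tu) ?(in_T_nonleaf Tv) //.
  by rewrite lin_fbasis bilin_fbasis.
rewrite [LHS](eq_supported_lin Tx E).
rewrite [x in RHS](lin_fbasis_id x) lin_lin.
rewrite !bilin_linl -lin_scalef -!lin_addf.
by apply: eq_lin => u _; rewrite ?lin_fbasis.
Qed.

Definition assoc_at t s r : Prop :=
  bilin dia (dia t s) (fbasis r) = bilin dia (fbasis t) (dia s r).

Definition monomial (x : F) t : Prop := exists c, x = c *: fbasis t.

Lemma monomial_fbasis t : monomial (fbasis t) t.
Proof. by exists 1; rewrite scale1r. Qed.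

Lemma monomial_beta t : monomial (beta t) (raise t).
Proof. by exists (bcoef lam j t); apply: beta_treeE. Qed.

Lemma assoc_monomial x y z t s r :
  monomial x t -> monomial y s -> monomial z r -> assoc_at t s r ->
  bilin dia (bilin dia x y) z = bilin dia x (bilin dia y z).
Proof.
move=> [a ->] [b ->] [c ->].
rewrite /assoc_at !(bilinZl, bilinZr, bilin_fbasis) !scalerA => ->.
by congr (_ *: _); ring.
Qed.

(** Both sides expand, by beta(u * v) = beta(u) beta(v) on the left and
    beta(v * w) = beta(v) beta(w) on the right, to the sum over the proper
    subsets of {u, v, w} of the product of the three trees in which beta is
    applied to the chosen ones, with a factor lam for all but one of the trees
    left alone.  The term in which beta is applied to all three does not occur,
    and this is what makes the weight decrease in [dia_assoc]. *)
Lemma ast_assoc u v w : in_That i j u -> in_T i j v -> in_That i j w ->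
  (~~ is_leaf u -> ~~ is_leaf w ->
   [/\ {in [:: v; raise v] & [:: w; raise w], forall y z, assoc_at u y z},
       {in [:: u; raise u] & [:: w; raise w], forall x z, assoc_at x v z} &
       {in [:: u; raise u] & [:: v; raise v], forall x y, assoc_at x y w}]) ->
  lin (fun x => star x w) (star u v) = lin (star u) (star v w).
Proof.
move=> hat_u Tv; case/orP: hat_u => [|Tu].
  by case: u => // _ _ _; rewrite ast_leafl lin_fbasis -lin_fbasis_id.
case/orP=> [|Tw].
  case: w => // _ _; rewrite ast_leafr lin_fbasis [RHS]lin_fbasis_id.
  by apply: eq_lin => x _; rewrite ast_leafr.
have [nl_u nl_v nl_w] :=
  And3 (in_T_nonleaf Tu) (in_T_nonleaf Tv) (in_T_nonleaf Tw).
move=> /(_ nl_u nl_w) A.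
rewrite -bilinEl -bilinEr !bilin_ast;
  do ?[exact: supported_fbasis | exact: ast_in_T].
rewrite -(Baxter_tree lam Tu Tv) -(Baxter_tree lam Tv Tw) !lin_fbasis.
rewrite (ast_nonleaf lam i j nl_u nl_v) (ast_nonleaf lam i j nl_v nl_w).
rewrite -!(bilin_fbasis dia) !(bilinDl, bilinDr, bilinZl, bilinZr).
have [fu bu] := (monomial_fbasis u, monomial_beta u).
have [fv bv] := (monomial_fbasis v, monomial_beta v).
have [fw bw] := (monomial_fbasis w, monomial_beta w).
case: A => Au Av Aw.
have inl t : t \in [:: t; raise t] by rewrite mem_head.
have inr t : raise t \in [:: t; raise t] by rewrite inE mem_head orbT.
rewrite (assoc_monomial bu bv fw (Aw _ _ (inr u) (inr v))).
rewrite (assoc_monomial bu fv bw (Av _ _ (inr u) (inr w))).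
rewrite (assoc_monomial fu bv bw (Au _ _ (inr v) (inr w))).
rewrite (assoc_monomial fu fv bw (Au _ _ (inl v) (inr w))).
rewrite (assoc_monomial bu fv fw (Aw _ _ (inr u) (inl v))).
rewrite (assoc_monomial fu bv fw (Aw _ _ (inl u) (inr v))).
rewrite (assoc_monomial fu fv fw (Aw _ _ (inl u) (inl v))).
move: (bilin dia (beta u) (bilin dia (beta v) (fbasis w))) => a1.
move: (bilin dia (beta u) (bilin dia (fbasis v) (beta w))) => a2.
move: (bilin dia (beta u) (bilin dia (fbasis v) (fbasis w))) => a3.
move: (bilin dia (fbasis u) (bilin dia (beta v) (beta w))) => a4.
move: (bilin dia (fbasis u) (bilin dia (beta v) (fbasis w))) => a5.
move: (bilin dia (fbasis u) (bilin dia (fbasis v) (beta w))) => a6.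
move: (bilin dia (fbasis u) (bilin dia (fbasis v) (fbasis w))) => a7.
rewrite !scalerDr !addrA.
by rewrite [LHS](ACl (1*2*5*3*6*4*7)%AC).
Qed.

Lemma dia_graftl q r : graft_stable q ->
  dia (graft i q) r = lin (fun w => fbasis (graft i (glue q w (degraft r))))
    (lin beta (star (lower (last_tree q)) (lower (first_tree (degraft r))))).
Proof.
move=> q_ok; rewrite diamondE degraft_graft // last_tree_normf.
by apply: eq_lin => w _; rewrite graft_glue_normfl.
Qed.

Lemma dia_graftr t q : graft_stable q ->
  dia t (graft i q) = lin (fun w => fbasis (graft i (glue (degraft t) w q)))
    (lin beta (star (lower (last_tree (degraft t))) (lower (first_tree q)))).
Proof.
move=> q_ok; rewrite diamondE degraft_graft //.
by apply: eq_lin => w _; rewrite graft_glue_normfr.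
Qed.

Lemma graft_stable_glue f w g : g.2 != [::] -> graft_stable (glue f w g).
Proof.
rewrite /graft_stable /glue => g_neq0; case: f.2 => [|p l] /=.
  by rewrite g_neq0.
by case: (belast p l).
Qed.

Lemma graft_stable_glue_pos f w g : (0 < label w)%N -> g.2 = [::] ->
  graft_stable (glue f w g).
Proof.
rewrite /graft_stable /glue => lw ->; case: f.2 => [|p l] /=.
  by rewrite lw.
by case: (belast p l).
Qed.

Lemma beta_label x : in_T i j x -> supported (fun w => 0 < label w)%N (beta x).
Proof.
move=> Tx; rewrite beta_treeE; apply/supportedZ/supported_fbasis.
by apply: label_raise; apply: in_T_nonleaf Tx.
Qed.

(** The two products change the first and the last letter of s, which are
    distinct, so they can be carried out in either order. *)
Lemma dia_assoc_split t s r : (degraft s).2 != [::] -> assoc_at t s r.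
Proof.
move=> g_neq0; rewrite /assoc_at bilinEl bilinEr.
rewrite [dia t s]diamondE [dia s r]diamondE [LHS]lin_lin [RHS]lin_lin.
set W := lin beta _; set W' := lin beta _.
transitivity (lin (fun w => lin (fun w' => fbasis (graft i
    (glue (glue (degraft t) w (degraft s)) w' (degraft r)))) W') W).
  apply: eq_lin => w _; rewrite lin_fbasis dia_graftl ?graft_stable_glue //.
  by rewrite last_tree_glue /W'; case: (degraft s).2 g_neq0.
rewrite exchange_lin; apply: eq_lin => w' _.
rewrite lin_fbasis dia_graftr.
  rewrite first_tree_glue /W; case E: (degraft s).2 g_neq0 => // _.
  by apply: eq_lin => w _; rewrite glueA // E.
by rewrite /graft_stable glueE //= splice_neq0.
Qed.

Lemma ast_in_Tl u v : in_That i j u -> in_T i j v ->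
  supported (in_T i j) (star u v).
Proof.
move=> hat_u Tv; case/orP: hat_u => [|Tu]; last exact: ast_in_T.
by case: u => // _; apply: supported_fbasis.
Qed.

Lemma ast_in_Tr u v : in_T i j u -> in_That i j v ->
  supported (in_T i j) (star u v).
Proof.
move=> Tu /orP[|Tv]; last exact: ast_in_T.
by case: v => // _; rewrite ast_leafr; apply: supported_fbasis.
Qed.

(** Here s is one letter, and both sides glue the forests of t and r along a
    single letter, which runs over beta((u * s') * v) on the left and over
    beta(u * (s' * v)) on the right, where s' is s lowered. *)
Lemma dia_assoc_single t s r : in_T i j t -> in_T i j s -> in_T i j r ->
  let u := lower (last_tree (degraft t)) in
  let v := lower (first_tree (degraft r)) in
  degraft s = (s, [::]) -> in_T i j (lower s) ->
  lin (fun x => star x v) (star u (lower s)) =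
    lin (star u) (star (lower s) v) ->
  assoc_at t s r.
Proof.
move=> Tt Ts Tr u v ds Tm star_assoc; rewrite /assoc_at bilinEl bilinEr.
have hat_u : in_That i j u by apply/lower_in_That/last_tree_pos.
have hat_v : in_That i j v by apply/lower_in_That/first_tree_pos.
have Tum := ast_in_Tl hat_u Tm; have Tmv := ast_in_Tr Tm hat_v.
pose G w := fbasis (graft i (glue (degraft t) w (degraft r))) : F.
rewrite [dia t s]diamondE [dia s r]diamondE [LHS]lin_lin [RHS]lin_lin ds.
have betaW x : supported (in_T i j) x ->
    supported (fun w => 0 < label w)%N (lin beta x).
  by move=> Tx; apply: supported_lin Tx beta_label.
transitivity (lin G (lin beta (lin (fun x => star x v) (star u (lower s))))).
  transitivity (lin (fun w => lin G (lin beta (star (lower w) v)))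
      (lin beta (star u (lower s)))).
    apply: eq_supported_lin (betaW _ Tum) _ => w w_pos.
    rewrite lin_fbasis dia_graftl ?graft_stable_glue_pos // last_tree_glue.
    by apply: eq_lin => w' _; rewrite glue_single_absorb.
  rewrite -lin_lin; congr (lin G _); rewrite !lin_lin.
  by apply: eq_supported_lin Tum _ => x Tx; apply: beta_ast_lowerl.
rewrite star_assoc.
transitivity (lin (fun w => lin G (lin beta (star u (lower w))))
      (lin beta (star (lower s) v))); last first.
  apply: eq_supported_lin (betaW _ Tmv) _ => w w_pos.
  by rewrite lin_fbasis dia_graftr // /graft_stable /= w_pos orbT.
rewrite -lin_lin; congr (lin G _); rewrite !lin_lin.
by apply: eq_supported_lin Tmv _ => x Tx; rewrite beta_ast_lowerr.
Qed.

Lemma weight_lower t : (weight (lower t) <= weight t)%N.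
Proof. by case: t => //= a t s; lia. Qed.

Lemma weight_lower_lt t : ~~ is_leaf t -> in_That_pos i j t ->
  (weight (lower t) < weight t)%N.
Proof. by case: t => // [[|a]] t s //= _; rewrite /in_That_pos /= andbF. Qed.

(** Raising a lowered letter gives back the letter. *)
Lemma lower_small w : ~~ is_leaf w -> in_That_pos i j w ->
  {in [:: lower w; raise (lower w)],
     forall x, in_T i j x /\ (weight x <= weight w)%N}.
Proof.
move=> nl_w pos_w x; rewrite !inE (raise_lower pos_w) => /orP[]/eqP->.
  split; last exact: weight_lower.
  by have := lower_in_That pos_w; rewrite /in_That is_leaf_lower (negPf nl_w).
by move: pos_w; rewrite /in_That_pos (negPf nl_w) => /andP[].
Qed.

Lemma weight_last_tree t : (weight (last_tree (degraft t)) <= weight t)%N.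
Proof.
rewrite /last_tree; case: t => [|[|a] t s] //=.
elim: s t => [|p s IH] t /=; first by lia.
by have := IH p.2; lia.
Qed.

Lemma weight_first_tree t : (weight (first_tree (degraft t)) <= weight t)%N.
Proof. by rewrite /first_tree; case: t => [|[|a] t s] //=; lia. Qed.

(** In the case of a single middle letter the trees u, s', v are the letters at
    the junctions, lowered.  Each is lighter than its letter, and the raised
    one is no heavier than its letter; so any triple with at least one tree
    not raised is lighter than (t, s, r). *)
Lemma dia_assoc t s r :
  in_T i j t -> in_T i j s -> in_T i j r -> assoc_at t s r.
Proof.
have [n] := ubnP (weight t + weight s + weight r)%N.
elim: n t s r => // n IH t s r lt_n Tt Ts Tr.
have [ds|] := eqVneq (degraft s).2 [::]; last exact: dia_assoc_split.
have [ds' s_pos] := degraft_single Ts ds.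
have hat_s := in_T_pos_hat Ts s_pos.
have Tm : in_T i j (lower s).
  have := lower_in_That hat_s; rewrite /in_That is_leaf_lower.
  by case: (s) Ts.
apply: dia_assoc_single => //.
have pos_u := last_tree_pos Tt; have pos_v := first_tree_pos Tr.
have le_u := weight_last_tree t; have le_v := weight_first_tree r.
move: (last_tree _) (first_tree _) pos_u pos_v le_u le_v.
move=> u v pos_u pos_v le_u le_v.
apply: ast_assoc => //; rewrite ?lower_in_That // !is_leaf_lower => nl_u nl_v.
have nl_s := in_T_nonleaf Ts.
have := weight_lower_lt nl_u pos_u; have := weight_lower_lt nl_v pos_v.
have := weight_lower_lt nl_s hat_s => lt_s lt_v lt_u.
have [Tlu _] := lower_small nl_u pos_u (mem_head _ _).
have [Tlv _] := lower_small nl_v pos_v (mem_head _ _).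
have [Tu Tv Ts'] := And3 (lower_small nl_u pos_u) (lower_small nl_v pos_v)
  (lower_small nl_s hat_s).
split=> x y.
- move=> /Ts'[Tx le_x] /Tv[Ty le_y]; apply: IH => //.
  by clear -lt_n lt_u lt_v lt_s le_u le_v le_x le_y; lia.
- move=> /Tu[Tx le_x] /Tv[Ty le_y]; apply: IH => //.
  by clear -lt_n lt_u lt_v lt_s le_u le_v le_x le_y; lia.
- move=> /Tu[Tx le_x] /Ts'[Ty le_y]; apply: IH => //.
  by clear -lt_n lt_u lt_v lt_s le_u le_v le_x le_y; lia.
Qed.

End Associativity.

(** * The free module as an object of the category *)

Section FreeBaxter.
Context (k : comPzRingType) (lam : k) (i j : tindex).

Local Notation F := (freemod k dtree).
Local Notation Bm := (Bmod k i j).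
Local Notation "'beta'" := (beta_tree lam j).
Local Notation "'dia'" := (diamond lam i j).
Local Notation "'star'" := (ast lam i j).

(** Since the embedding into the module on all trees is injective, identities in
    B can be proved there, where the products are defined by recursion. *)
Lemma BembK : cancel (@Bemb k i j) (@Brestr k i j).
Proof.
move=> x; rewrite /Bemb /Brestr lin_lin [RHS]lin_fbasis_id.
by apply: eq_lin => t _; rewrite lin_fbasis valK.
Qed.

Lemma Bemb_supported (x : Bm) : supported (in_T i j) (Bemb x).
Proof.
apply: (supported_lin (Q := predT)) => // t _.
exact/supported_fbasis/tvalP.
Qed.

Lemma Bemb_mul (x y : Bm) :
  Bemb (Bmul lam x y) = bilin dia (Bemb x) (Bemb y).
Proof.
rewrite /Bmul {1}/bilin /Bemb lin_lin bilin_linl; apply: eq_lin => t _.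
rewrite lin_lin bilin_linr; apply: eq_lin => s _.
by rewrite bilin_fbasis -[RHS]BmulE /Bmul bilin_fbasis.
Qed.

Lemma Bemb_beta (x : Bm) : Bemb (Bbeta lam x) = lin beta (Bemb x).
Proof.
rewrite /Bbeta /Bemb !lin_lin; apply: eq_lin => t _.
by rewrite [RHS]lin_fbasis -[RHS]BbetaE /Bbeta lin_fbasis.
Qed.

Lemma bilin_dia_assoc (x y z : F) : supported (in_T i j) x ->
  supported (in_T i j) y -> supported (in_T i j) z ->
  bilin dia x (bilin dia y z) = bilin dia (bilin dia x y) z.
Proof.
move=> Tx Ty Tz; rewrite (lin_fbasis_id x).
rewrite [LHS]bilin_linl [bilin dia (lin _ x) y]bilin_linl [RHS]bilin_linl.
apply: eq_supported_lin Tx _ => t Tt; rewrite (lin_fbasis_id y).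
rewrite [bilin dia (lin _ y) z]bilin_linl [LHS]bilin_linr.
rewrite [bilin dia _ (lin _ y)]bilin_linr [RHS]bilin_linl.
apply: eq_supported_lin Ty _ => s Ts; rewrite (lin_fbasis_id z).
rewrite [bilin dia (fbasis s) _]bilin_linr [LHS]bilin_linr [RHS]bilin_linr.
apply: eq_supported_lin Tz _ => r Tr.
by rewrite !bilin_fbasis -dia_assoc.
Qed.

Lemma Baxter_bilin (x y : F) : supported (in_T i j) x ->
  supported (in_T i j) y ->
  bilin dia (lin beta x) (lin beta y) = lin beta (bilin star x y).
Proof.
move=> Tx Ty; rewrite bilin_linl /bilin lin_lin.
apply: eq_supported_lin Tx _ => t Tt.
rewrite -/(bilin _ _ _) bilin_linr lin_lin.
by apply: eq_supported_lin Ty _ => s Ts; apply: Baxter_tree.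
Qed.

Lemma Btriple_is_object : is_object lam i j (Btriple lam i j).
Proof.
split=> /=.
- split=> [a|b|a b c]; [exact: bilinr_linear | exact: bilinl_linear |].
  apply: (can_inj BembK); rewrite !Bemb_mul.
  by apply: bilin_dia_assoc; apply: Bemb_supported.
- split=> [|a b]; first exact: linearP.
  apply: (can_inj BembK); rewrite Bemb_mul !Bemb_beta Baxter_bilin;
    do ?exact: Bemb_supported.
  rewrite bilin_ast; do ?exact: Bemb_supported.
  by rewrite -!Bemb_beta -!Bemb_mul -linZ -!linD [RHS]Bemb_beta.
- move=> i2; apply: (can_inj BembK).
  rewrite BmulE diamondE /= lin_fbasis /= lin_fbasis /=.
  by rewrite /graft /= /Bemb lin_fbasis i2.
move=> j2 a; apply: (can_inj BembK).
rewrite !Bemb_beta [RHS]linZ -/(Bemb _) Bemb_beta [LHS]lin_lin -[RHS]lin_scalef.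
have Ta : supported (in_T i j) (Bemb a) by apply: Bemb_supported.
apply: (eq_supported_lin (V := F) Ta) => t Tt.
by apply: beta_beta => //; apply: in_T_nonleaf Tt.
Qed.

End FreeBaxter.

(** * Evaluating trees in an object *)

Section Evaluation.
Context (k : comPzRingType) (lam : k) (i j : tindex) (A : alg_data k).
Hypothesis objA : is_object lam i j A.
Implicit Types (t u v w : dtree) (s l : seq (nat * dtree)) (f g : forest).

Local Notation F := (freemod k dtree).
Local Notation "'beta'" := (beta_tree lam j).
Local Notation "'dia'" := (diamond lam i j).
Local Notation "'star'" := (ast lam i j).

(** The algebra k + A with a unit adjoined, in which the leaf has the value 1.
    Its operator fixes the unit, as beta fixes the leaf; it is a Baxter operator
    only on A. *)
Definition unital : lmodType k := (k^o * A)%type.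

Definition aug (x : unital) : k := x.1.

Definition umul (x y : unital) : unital :=
  (aug x * aug y, aug x *: y.2 + aug y *: x.2 + amul x.2 y.2).

Definition uone : unital := (1, 0).

Definition uop (x : unital) : unital := (x.1, aop x.2).

Let amulDl (a b c : A) : amul (a + b) c = amul a c + amul b c.
Proof. by have [[_ /(_ c 1 a b)]] := objA; rewrite !scale1r. Qed.

Let amulDr (a b c : A) : amul c (a + b) = amul c a + amul c b.
Proof. by have [[/(_ c 1 a b)]] := objA; rewrite !scale1r. Qed.

Let amul0l (b : A) : amul 0 b = 0.
Proof. by apply: (addIr (amul 0 b)); rewrite -amulDl !add0r. Qed.

Let amul0r (b : A) : amul b 0 = 0.
Proof. by apply: (addIr (amul b 0)); rewrite -amulDr !add0r. Qed.

Let amulZl c (a b : A) : amul (c *: a) b = c *: amul a b.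
Proof. by have [[_ /(_ b c a 0)]] := objA; rewrite !addr0 amul0l addr0. Qed.

Let amulZr c (a b : A) : amul b (c *: a) = c *: amul b a.
Proof. by have [[/(_ b c a 0)]] := objA; rewrite !addr0 amul0r addr0. Qed.

Let opD (a b : A) : aop (a + b) = aop a + aop b.
Proof. by have [_ [/(_ 1 a b)]] := objA; rewrite !scale1r. Qed.

Let op0 : aop (0 : A) = 0.
Proof. by apply: (addIr (aop 0)); rewrite -opD !add0r. Qed.

Let opZ c (a : A) : aop (c *: a) = c *: aop a.
Proof. by have [_ [/(_ c a 0)]] := objA; rewrite !addr0 op0 addr0. Qed.

Lemma umulA : associative umul.
Proof.
move=> [a x] [b y] [c z]; rewrite /umul /aug /=; congr pair; first exact: mulrA.
rewrite !(amulDl, amulDr, amulZl, amulZr, scalerDr, scalerA).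
have [[_ _ ->] _ _ _] := objA.
rewrite !addrA [b * c]mulrC [c * a]mulrC.
by rewrite [LHS](ACl (1*2*4*6*3*5*7)%AC).
Qed.

Lemma umul1x : left_id uone umul.
Proof.
by case=> c x; rewrite /umul /aug /= mul1r scale1r scaler0 amul0l !addr0.
Qed.

Lemma umulx1 : right_id uone umul.
Proof.
case=> c x.
by rewrite /umul /aug /= mulr1 scale1r scaler0 amul0r !add0r addr0.
Qed.

Lemma umull_linear y : linear (umul^~ y).
Proof.
move=> c [a x] [b z]; case: y => d y; rewrite /umul /aug /=; congr pair => /=.
  by change ((c * a + b) * d = c * (a * d) + b * d); ring.
rewrite amulDl amulZl !scalerDr scalerDl !scalerA [c * d]mulrC !addrA.
by rewrite [LHS](ACl (1*3*5*2*4*6)%AC).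
Qed.

Lemma umulr_linear y : linear (umul y).
Proof.
move=> c [a x] [b z]; case: y => d y; rewrite /umul /aug /=; congr pair => /=.
  by change (d * (c * a + b) = c * (d * a) + d * b); ring.
rewrite amulDr amulZr !scalerDr scalerDl !scalerA [c * d]mulrC !addrA.
by rewrite [LHS](ACl (1*3*5*2*4*6)%AC).
Qed.

Lemma umulZl c x y : umul (c *: x) y = c *: umul x y.
Proof.
have umul0 : umul 0 y = 0.
  by rewrite /umul /aug /= amul0l scale0r scaler0 !addr0 mul0r.
by have := umull_linear y c x 0; rewrite !addr0 umul0 addr0.
Qed.

Lemma umulZr c x y : umul x (c *: y) = c *: umul x y.
Proof.
have umul0 : umul x 0 = 0.
  by rewrite /umul /aug /= amul0r scale0r scaler0 !addr0 mulr0.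
by have := umulr_linear x c y 0; rewrite !addr0 umul0 addr0.
Qed.

Lemma uop_linear : linear uop.
Proof. by move=> c [a x] [b y]; rewrite /uop /= opD opZ. Qed.

Definition upoint : unital := (0, apoint A).

(** For i = 2 the label 0 is also sent to y, since angles add by 1 + 1 = 1:
    with this value the sum of angles goes to the product for all labels. *)
Definition ypow (n : nat) : unital :=
  if i is Two then upoint else iter n (umul upoint) uone.

Lemma ypow_add a b : ypow (add_angle i a b) = umul (ypow a) (ypow b).
Proof.
rewrite /ypow /add_angle; have [_ _ point2 _] := objA.
case: i point2 => [/(_ erefl) yy|_].
  by rewrite /umul /aug /= mul0r !scale0r !add0r yy.
by elim: a => [|a IH]; rewrite ?umul1x //= IH umulA.
Qed.

Fixpoint ev t : unital :=
  if t is Node a t0 s then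
    iter a uop (umul (ev t0)
      (foldr (fun p x => umul (umul (ypow p.1) (ev p.2)) x) uone s))
  else uone.

Definition evs l : unital :=
  foldr (fun p x => umul (umul (ypow p.1) (ev p.2)) x) uone l.

Definition evf f : unital := umul (ev f.1) (evs f.2).

Lemma evs_cat l l' : evs (l ++ l') = umul (evs l) (evs l').
Proof. by elim: l => [|p l IH] /=; rewrite ?umul1x // IH umulA. Qed.

(** Removing a leaf does not change the value, because the leaf has the value 1
    and the merged angle has the product of the two values. *)
Lemma evs_norm l : evs (norm i l) = evs l.
Proof.
case: l => [//|[a u] l]; elim: l a u => [//|[b v] l IH] a u /=.
case: ifP => [|_] /=; last by rewrite IH.
by case: u => // _; rewrite IH /= umulx1 ypow_add !umulA.
Qed.

Lemma ev_graft f : ev (graft i f) = evf f.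
Proof.
have [f0|f_neq0] := eqVneq f.2 [::].
  by case: f f0 => t l /= ->; rewrite /evf umulx1.
by rewrite graftE //= -/(evs _) evs_norm.
Qed.

Lemma evf_degraft t : evf (degraft t) = ev t.
Proof. by case: t => [|[|a] t s]; rewrite /evf /= ?umulx1. Qed.

(** The value of the word without its last letter. *)
Definition ev_init f : unital :=
  if f.2 is p :: l
  then umul (ev f.1) (umul (evs (belast p l)) (ypow (last p l).1)) else uone.

Lemma evf_glue f w g :
  evf (glue f w g) = umul (umul (ev_init f) (ev w)) (evs g.2).
Proof.
rewrite /evf /glue /ev_init; case: f.2 => [|p l] /=; first by rewrite umul1x.
by rewrite evs_cat /= !umulA.
Qed.

Lemma evf_last f : evf f = umul (ev_init f) (ev (last_tree f)).
Proof.
case: f => t [|p l]; rewrite /evf /ev_init /last_tree /=.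
  by rewrite umul1x umulx1.
transitivity (umul (ev t) (evs (rcons (belast p l) (last p l)))).
  by rewrite -lastI.
rewrite -cats1 evs_cat /= umulx1 !umulA.
by rewrite (last_map (fun q : nat * dtree => q.2)).
Qed.

Lemma aug_mul x y : aug (umul x y) = aug x * aug y.
Proof. by []. Qed.

Lemma aug_op n x : aug (iter n uop x) = aug x.
Proof. by elim: n. Qed.

Lemma aug_ypow n : angle_ok i n -> aug (ypow n) = 0.
Proof.
rewrite /ypow /angle_ok; case: i => //; case: n => // n _.
by rewrite [iter _ _ _]/= aug_mul mul0r.
Qed.

(** A word with at least one power of Y has its value in the ideal A. *)
Lemma aug_ev t : in_T i j t -> aug (ev t) = 0.
Proof.
case: t => // a t [|[n u] s]; rewrite in_T_Node ?andbF //.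
move=> /and3P[_ _ /andP[/andP[ok_n _] _]].
by rewrite [ev _]/= aug_op !aug_mul aug_ypow // !mul0r mulr0.
Qed.

Local Notation E := (lin ev).

(** For j = 2 and root label 1 this is beta^2 = - lam beta in A; it uses that
    the value lies in A, as the operator fixes the unit. *)
Lemma ev_beta t : in_T i j t -> E (beta t) = uop (ev t).
Proof.
case: t => // a t s Tt; have := aug_ev Tt; have := in_T_label_ok Tt.
rewrite beta_treeE linZ lin_fbasis /label_ok /bcoef /raise.
have [_ _ _] := objA.
case: j => [/(_ erefl) op2|_ _ _]; last by rewrite scale1r.
case: a {Tt} => [_ _|[|//] _]; first by rewrite expr0 scale1r.
have -> : ev (Node 1 t s) = uop (umul (ev t) (evs s)) by [].
case: (umul _ _) => c x; rewrite expr1 /aug /uop /= => ->.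
congr pair; last by rewrite op2.
exact: mulr0.
Qed.

Lemma ev_beta_lin (x : F) :
  supported (in_T i j) x -> E (lin beta x) = uop (E x).
Proof.
move=> Tx; rewrite (linear_lin _ _ uop_linear) [LHS]lin_lin.
exact: eq_supported_lin Tx ev_beta.
Qed.

Lemma aug_lin (x : F) : supported (in_T i j) x -> aug (E x) = 0.
Proof.
move=> Tx; have aug_linear : linear (aug : unital -> k^o) by [].
rewrite (linear_lin _ _ aug_linear) /lin big_seq big1 // => t /Tx Tt.
by rewrite /= aug_ev // scaler0.
Qed.

Lemma uop_Baxter x y : aug x = 0 -> aug y = 0 ->
  umul (uop x) (uop y) =
  uop (umul (uop x) y + umul x (uop y) + lam *: umul x y).
Proof.
case: x y => a x [b y]; rewrite /aug /= => -> ->.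
have [_ [_ Bax] _ _] := objA.
rewrite /umul /uop /aug /= !scale0r !add0r Bax; congr pair.
by rewrite !mul0r !add0r; apply: esym; apply: mulr0.
Qed.

Lemma ev_lower_beta w : in_That_pos i j w -> uop (ev (lower w)) = ev w.
Proof.
move=> pos_w; have := beta_lower lam pos_w.
case: w pos_w => [|a t s] pos_w; first by rewrite /uop /= op0.
have : in_That i j (lower (Node a t s)) by apply: lower_in_That.
by move=> Tw e; rewrite -ev_beta // e lin_fbasis.
Qed.

Definition ev_mul_at t u : Prop := E (dia t u) = umul (ev t) (ev u).

Lemma ev_beta_ast u v : in_That i j u -> in_That i j v ->
    (~~ is_leaf u -> ~~ is_leaf v ->
     [/\ ev_mul_at (raise j u) v, ev_mul_at u (raise j v) & ev_mul_at u v]) ->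
  E (lin beta (star u v)) = umul (uop (ev u)) (uop (ev v)).
Proof.
have uop1 : uop uone = uone by rewrite /uop /= op0.
have hat_beta t : in_That i j t -> E (beta t) = uop (ev t).
  case/orP=> [|/ev_beta //]; case: t => // _.
  by rewrite /= lin_fbasis uop1.
move=> hat_u hat_v.
case leaf_u : (is_leaf u).
  case: u leaf_u {hat_u} => // _ _.
  by rewrite ast_leafl lin_fbasis hat_beta // uop1 umul1x.
case leaf_v : (is_leaf v).
  case: v leaf_v {hat_v} => // _ _.
  by rewrite ast_leafr lin_fbasis hat_beta // uop1 umulx1.
move: hat_u hat_v; rewrite /in_That leaf_u leaf_v => Tu Tv.
case=> // mul1 mul2 mul3.
rewrite ev_beta_lin; last exact: ast_in_T.
rewrite uop_Baxter ?aug_ev //; congr uop.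
rewrite ast_nonleaf ?leaf_u ?leaf_v // !linD !linZ -!ev_beta // mul3.
rewrite !beta_treeE !bilinZl !bilinZr !bilin_fbasis !linZ mul1 mul2 !lin_fbasis.
by rewrite umulZl umulZr.
Qed.

(** The value of the product differs from the product of the values only at the
    junction, where it is the Baxter identity of A ([ev_beta_ast]). *)
Lemma ev_mul t u : in_T i j t -> in_T i j u -> ev_mul_at t u.
Proof.
have [n] := ubnP (weight t + weight u)%N.
elim: n t u => // n IH t u lt_n Tt Tu; rewrite /ev_mul_at.
have pos_x := last_tree_pos Tt; have pos_y := first_tree_pos Tu.
have le_x := weight_last_tree t; have le_y := weight_first_tree u.
rewrite diamondE lin_lin.
have -> : ev u = umul (ev (first_tree (degraft u))) (evs (degraft u).2).
  by rewrite -evf_degraft.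
rewrite -[ev t]evf_degraft evf_last.
transitivity (lin (fun w => umul (umul (ev_init (degraft t)) (ev w))
    (evs (degraft u).2)) (lin beta (star (lower (last_tree (degraft t)))
                                     (lower (first_tree (degraft u)))))).
  by apply: eq_lin => w _; rewrite lin_fbasis ev_graft evf_glue.
have lin_h : linear (fun x =>
    umul (umul (ev_init (degraft t)) x) (evs (degraft u).2)).
  by move=> c x y /=; rewrite umulr_linear umull_linear.
rewrite -(linear_lin _ _ lin_h) {lin_h} [RHS]umulA; congr (umul _ _).
rewrite -[RHS]umulA.
move: (last_tree _) (first_tree _) pos_x pos_y le_x le_y.
move=> x y pos_x pos_y le_x le_y; congr (umul _ _).
rewrite ev_beta_ast ?lower_in_That //; first by rewrite !ev_lower_beta.
rewrite !is_leaf_lower => nl_x nl_y.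
have lt_x := weight_lower_lt nl_x pos_x.
have lt_y := weight_lower_lt nl_y pos_y.
have Sx := lower_small nl_x pos_x; have Sy := lower_small nl_y pos_y.
have inl w : w \in [:: w; raise j w] by rewrite mem_head.
have inr w : raise j w \in [:: w; raise j w] by rewrite inE mem_head orbT.
have [[Tx wx] [Tx' wx']] := (Sx _ (inl _), Sx _ (inr _)).
have [[Ty wy] [Ty' wy']] := (Sy _ (inl _), Sy _ (inr _)).
by split; apply: IH => //; clear -lt_n lt_x lt_y le_x le_y wx' wy'; lia.
Qed.

Definition Beval (x : Bmod k i j) : A := (E (Bemb x)).2.

Lemma Beval_morphism : @is_morphism k (Btriple lam i j) A Beval.
Proof.
have augB (x : Bmod k i j) : aug (E (Bemb x)) = 0.
  by apply/aug_lin/Bemb_supported.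
have E_mul (x y : F) : supported (in_T i j) x -> supported (in_T i j) y ->
    E (bilin dia x y) = umul (E x) (E y).
  move=> Tx Ty; rewrite [LHS]lin_lin (linear_lin _ _ (umull_linear (E y))).
  apply: eq_supported_lin Tx _ => t Tt.
  rewrite [LHS]lin_lin /= (linear_lin _ _ (umulr_linear (ev t))).
  by apply: eq_supported_lin Ty _ => u Tu; apply: ev_mul.
split.
- by move=> c x y; rewrite /Beval /Bemb !linearP.
- move=> x y; rewrite /Beval Bemb_mul E_mul; do ?exact: Bemb_supported.
  by rewrite /umul /= !augB !scale0r !add0r.
- have evY : ev (Ytree i j) = umul uone (umul (umul (ypow 1) uone) uone) by [].
  rewrite /Beval /Bemb !lin_fbasis evY umul1x !umulx1 /ypow.
  by case: (i); rewrite // [iter _ _ _]/= umulx1.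
by move=> x; rewrite /Beval Bemb_beta ev_beta_lin //; apply: Bemb_supported.
Qed.

End Evaluation.

(** * Generation by Y *)

Section Generation.
Context (k : comPzRingType) (lam : k) (i j : tindex).
Implicit Types (t u w : dtree) (s : seq (nat * dtree)).

Local Notation "'dia'" := (diamond lam i j).

Lemma norm_id b u s :
  all (predC is_leaf) (belast u (branches s)) ->
  norm i ((b, u) :: s) = (b, u) :: s.
Proof.
elim: s b u => [//|[c v] s IH] b u /=.
by move=> /andP[/negPf-> /(IH c v)/= ->].
Qed.

Lemma dia_last_leaf t u : in_T i j u -> last_tree (degraft t) = Leaf ->
  dia t u =
    fbasis (graft i (glue (degraft t) (first_tree (degraft u)) (degraft u))).
Proof.
move=> Tu last_t; rewrite diamondE last_t ast_leafl lin_fbasis.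
by rewrite (beta_lower _ (first_tree_pos Tu)) lin_fbasis.
Qed.

Lemma dia_first_leaf t u : in_T i j t -> first_tree (degraft u) = Leaf ->
  dia t u =
    fbasis (graft i (glue (degraft t) (last_tree (degraft t)) (degraft u))).
Proof.
move=> Tt first_u; rewrite diamondE first_u ast_leafr lin_fbasis.
by rewrite (beta_lower _ (last_tree_pos Tt)) lin_fbasis.
Qed.

Lemma dia_Y u : in_T i j u ->
  dia (Ytree i j) u = fbasis (Node 0 Leaf
    (norm i ((1%N, first_tree (degraft u)) :: (degraft u).2))).
Proof. by move=> Tu; rewrite dia_last_leaf. Qed.

Section Induction.
Variable P : Bmod k i j -> Prop.
Hypothesis P_point : P (fbasis (Ytree i j)).
Hypothesis P_op : forall x, P x -> P (Bbeta lam x).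
Hypothesis P_mul : forall x y, P x -> P y -> P (Bmul lam x y).

Let G t : Prop := forall Tt : in_T i j t, P (fbasis (TTree Tt)).

Let G_mul t u w : in_T i j t -> in_T i j u -> dia t u = fbasis w ->
  G t -> G u -> G w.
Proof.
move=> Tt Tu e Gt Gu Tw.
suff -> : fbasis (TTree Tw) = Bmul lam (fbasis (TTree Tt)) (fbasis (TTree Tu)).
  by apply: P_mul.
by apply: (can_inj (@BembK _ _ _)); rewrite BmulE e /Bemb lin_fbasis.
Qed.

Let G_beta t w : in_T i j t -> beta_tree lam j t = fbasis w -> G t -> G w.
Proof.
move=> Tt e Gt Tw; suff -> : fbasis (TTree Tw) = Bbeta lam (fbasis (TTree Tt)).
  exact: P_op.
by apply: (can_inj (@BembK _ _ _)); rewrite BbetaE e /Bemb lin_fbasis.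
Qed.

Let G_all t : G t.
Proof.
have TY := valP (Ytree i j).
have GY : G (Ytree i j).
  by move=> TY'; rewrite (_ : TTree TY' = Ytree i j) //; apply: val_inj.
elim/dtree_nested_ind: t => [//|a t s Gt Gs].
elim: a => [|a IHa]; last first.
  move=> Tw; apply: (G_beta _ _ IHa) (Tw).
    by apply: in_T_relabel (Tw); apply: label_okW (in_T_label_ok Tw).
  apply: (beta_lower lam (t := Node a.+1 t s)); exact: in_T_pos_hat Tw _.
elim: s t Gt Gs => [|[b u] s IHs] t Gt /=.
  by move=> _ Tw; exfalso; move: Tw; rewrite in_T_Node andbF.
move=> [Gu Gs] Tw; have Tw' := Tw; rewrite in_T_Node in Tw'.
move: Tw' => /and5P[ok_0 _ ok_b nl_s /andP[pos_t pos_s]].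
have norm_s c : norm i ((c, u) :: s) = (c, u) :: s by apply: norm_id.
have T_tail c t' : angle_ok i c -> in_That_pos i j t' ->
    in_T i j (Node 0 t' ((c, u) :: s)).
  move=> ok_c pos_t'; rewrite in_T_Node ok_0 pos_t' nl_s pos_s !andbT /= ok_c.
  by case/andP: ok_b.
have GL c : angle_ok i c -> G (Node 0 Leaf ((c, u) :: s)).
  clear Tw; elim: c => [//|c IHc] ok_c; have Tc := T_tail c.+1 Leaf ok_c isT.
  case: c => [|c] in IHc ok_c Tc *.
    (* The word is Y, or Y times u, or Y times a word that begins with u. *)
    case: s => [|[c v] s'] in IHs norm_s Gs nl_s Tc {IHc T_tail} ok_b pos_s *.
      case leaf_u: (is_leaf u).
        by have -> : u = Leaf by case: (u) leaf_u.
      have pos_u : in_That_pos i j u by case/andP: pos_s.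
      have /andP[Tu lu] : in_T i j u && (0 < label u)%N.
        by move: pos_u; rewrite /in_That_pos leaf_u.
      by apply: (G_mul TY Tu) GY Gu; rewrite dia_Y // degraft_pos.
    have Tu : in_T i j (Node 0 u ((c, v) :: s')).
      move: nl_s ok_b pos_s => /andP[_ nl_s] /andP[_ ok_s] /andP[pos_u pos_s].
      by rewrite in_T_Node; apply/and5P; split=> //; apply/andP.
    apply: (G_mul TY Tu) GY _; first by rewrite dia_Y // norm_s.
    exact: IHs.
  have ok_c1 : angle_ok i c.+1 by move: ok_c; rewrite /angle_ok; case: (i).
  apply: (G_mul TY (T_tail c.+1 Leaf ok_c1 isT)) GY (IHc ok_c1).
  rewrite dia_Y; last exact: T_tail.
  have -> : c.+2 = add_angle i 1 c.+1.
    by move: ok_c; rewrite /angle_ok /add_angle; case: (i).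
  by congr (fbasis (Node _ _ _)); rewrite -[RHS]norm_s.
have ok_b1 : angle_ok i b by case/andP: ok_b.
case leaf_t: (is_leaf t).
  by case: t leaf_t Tw {Gt T_tail pos_t} => // _ Tw; apply: GL.
have /andP[Tt t_pos] : in_T i j t && (0 < label t)%N.
  by move: pos_t; rewrite /in_That_pos leaf_t.
apply: (G_mul Tt (T_tail b Leaf ok_b1 isT) _ Gt (GL b ok_b1)) (Tw).
by rewrite dia_first_leaf // degraft_pos // graftE // [(glue _ _ _).2]/= norm_s.
Qed.

(** A positive root label is produced by beta.  In a word, a first letter other
    than the leaf is a left factor; without it the word begins with a power of
    Y, which multiplication by Y on the left produces one unit at a time. *)
Lemma generated_by_Y (t : Ttree i j) : P (fbasis t).
Proof. by case: t => t Tt; apply: G_all. Qed.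

End Induction.

End Generation.

Theorem proposition2p4 (k : comPzRingType) (lam : k) (i j : tindex) :
  is_initial_object lam i j (Btriple lam i j).
Proof.
split=> [|A objA]; first exact: Btriple_is_object.
exists (@Beval k i j A); split=> [|g [g_lin g_mul g_point g_op]].
  exact: Beval_morphism.
have [f_lin f_mul f_point f_op] := Beval_morphism objA.
apply: (linear_ext g_lin f_lin) => t.
apply: (generated_by_Y (lam := lam) (P := fun x => g x = Beval A x)).
- by rewrite g_point f_point.
- by move=> x e; rewrite g_op f_op e.
by move=> x y ex ey; rewrite g_mul f_mul ex ey.
Qed.
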